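(* For every finitely approximable variety $\mathbf V$ of Heyting algebras, the category $\mathbf{HD}^{\mathbf V}$ is dual to (i.e. equivalent to the opposite of) the category $\mathbf{M_H}^{\mathbf V}$.
   Context: A variety $\mathbf V$ of Heyting algebras is finitely approximable if every finitely generated free $\mathbf V$-algebra embeds into a product of finite $\mathbf V$-algebras. Finite posets with a greatest element (the root $\rho(P)$) are called rooted; for $p\in P$, $\downarrow p=\{p'\le p\}$; $\mathcal D(P)$ denotes the Heyting algebra of downward closed subsets of $P$. Let $\mathbf P_0^{\mathbf V}$ be the category of finite rooted posets $P$ with $\mathcal D(P)\in\mathbf V$, whose morphisms $h:Q\to P$ are open (p-)morphisms: order-preserving maps such that whenever $p'\le h(q)$ there is $q'\le q$ with $h(q')=p'$. For a finite poset $L$, $h_L$ is the presheaf on $\mathbf P_0^{\mathbf V}$ with $h_L(P)$ the set of order-preserving maps $u:P\to L$ ($L$-evaluations) and restriction $u\mapsto u\circ h$. For $u:P\to L$, $u_p$ is the restriction of $u$ to $\downarrow p$. Define $u\sim_0 v$ iff $u(\rho(P))=v(\rho(Q))$, and $u\sim_{n+1}v$ iff for every $p\in P$ there is $q\in Q$ with $u_p\sim_n v_q$ and for every $q\in Q$ there is $p\in P$ with $u_p\sim_n v_q$. A natural transformation $f:h_L\to h_M$ has b-index $n$ if $u\sim_n v$ implies $f(u)\sim_0 f(v)$ for all $L$-evaluations $u,v$. $\mathbf{M_H}^{\mathbf V}$ is the category whose objects are the presheaves $h_L$ on $\mathbf P_0^{\mathbf V}$ ($L$ a finite poset) and whose morphisms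 are natural transformations having a b-index. $\mathbf{HD}^{\mathbf V}$ is the category of $\mathbf V$-algebras freely generated (in $\mathbf V$) by a finite bounded distributive lattice, with Heyting algebra homomorphisms. *)

(* Defs.v *)
From HB Require Import structures.
From mathcomp Require Import all_boot all_order.
From mathcomp Require Import boolp.

Set Implicit Arguments.
Unset Strict Implicit.
Unset Printing Implicit Defensive.

Import Order.Theory.
Local Open Scope order_scope.

(** * Heyting algebras *)

HB.mixin Record isHeyting d T of Order.TBDistrLattice d T := {
  himp : T -> T -> T;
  himpP : forall x y z : T, (x <= himp y z) = (x `&` y <= z);
}.

#[short(type="heytingType")]
HB.structure Definition Heyting d :=
  { T of Order.TBDistrLattice d T & isHeyting d T }.

#[short(type="finHeytingType")]
HB.structure Definition FinHeyting d := { T of Finite T & Heyting d T }.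

(* MathComp's {tblmorphism _ -> _} only records the preservation of \bot and
   \top, so it has to be joined with {lmorphism _ -> _}. *)
HB.structure Definition BoundedLatticeMorphism
    d (T : tbLatticeType d) d' (T' : tbLatticeType d') :=
  { f of @Order.LatticeMorphism d T d' T' f
       & @Order.TBLatticeMorphism d T d' T' f }.

Notation "{ 'bdlmorphism' T -> T' }" :=
  (@BoundedLatticeMorphism.type _ T%type _ T'%type)
  (T at level 98, T' at level 99,
   format "{ 'bdlmorphism'  T  ->  T' }") : type_scope.

HB.mixin Record isHeytingMorphism d (T : heytingType d)
    d' (T' : heytingType d') (f : T -> T') := {
  hmorphX_subproof : {morph f : x y / himp x y};
}.

HB.structure Definition HeytingMorphism
    d (T : heytingType d) d' (T' : heytingType d') :=
  { f of @BoundedLatticeMorphism d T d' T' f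
       & isHeytingMorphism d T d' T' f }.

Notation "{ 'hmorphism' T -> T' }" :=
  (@HeytingMorphism.type _ T%type _ T'%type)
  (T at level 98, T' at level 99,
   format "{ 'hmorphism'  T  ->  T' }") : type_scope.

Section HeytingMorphismTheory.
Variables (d : Order.disp_t) (T : heytingType d).
Variables (d' : Order.disp_t) (T' : heytingType d').

Lemma hmorphX (f : {hmorphism T -> T'}) : {morph f : x y / himp x y}.
Proof. exact: hmorphX_subproof. Qed.

Lemma hmorphism_ext (f g : {hmorphism T -> T'}) : f =1 g -> f = g.
Proof.
case: f g => f cf [g cg] /= /funext fg; case: g / fg cg => cg.
congr HeytingMorphism.Pack.
case: cf cg => [[?] [?] [?] [?] [?] [?]] [[?] [?] [?] [?] [?] [?]].
by do 2 f_equal; apply: Prop_irrelevance.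
Qed.

End HeytingMorphismTheory.

Section HeytingMorphismIdComp.
Variables (d : Order.disp_t) (T : heytingType d).
Variables (d' : Order.disp_t) (T' : heytingType d').
Variables (d'' : Order.disp_t) (T'' : heytingType d'').

Fact idfun_is_himp_morphism : {morph (@idfun T) : x y / himp x y}.
Proof. by []. Qed.
HB.instance Definition _ :=
  isHeytingMorphism.Build d T d T idfun idfun_is_himp_morphism.

Fact comp_is_himp_morphism (f : {hmorphism T' -> T''}) (g : {hmorphism T -> T'}) :
  {morph (f \o g) : x y / himp x y}.
Proof. by move=> x y /=; rewrite !hmorphX. Qed.
HB.instance Definition _ (f : {hmorphism T' -> T''}) (g : {hmorphism T -> T'}) :=
  isHeytingMorphism.Build d T d'' T'' (f \o g) (comp_is_himp_morphism f g).

End HeytingMorphismIdComp.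

Record heytAlg := HeytAlg {
  heyt_disp : Order.disp_t;
  heyt_sort :> heytingType heyt_disp }.

Record finHeytAlg := FinHeytAlg {
  fheyt_disp : Order.disp_t;
  fheyt_sort :> finHeytingType fheyt_disp }.

Definition heytAlg_of_fin (A : finHeytAlg) : heytAlg :=
  @HeytAlg (fheyt_disp A) (fheyt_sort A).

(** ** Products *)

Section Product.
Variables (I : Type) (A : I -> heytAlg).

Definition hprod := forall i, A i.

HB.instance Definition _ := gen_eqMixin hprod.
HB.instance Definition _ := gen_choiceMixin hprod.

Implicit Types x y z : hprod.

Let le x y : bool := `[< forall i, x i <= y i >].
Let lt x y : bool := (y != x) && le x y.
Let meet x y : hprod := fun i => x i `&` y i.
Let join x y : hprod := fun i => x i `|` y i.

Fact hprod_le_def x y : le x y = (meet x y == x).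
Proof.
apply/asboolP/eqP => [xy|xy i].
  by apply: functional_extensionality_dep => i; apply/meet_idPl/xy.
by apply/meet_idPl; rewrite -[in RHS]xy.
Qed.
Fact hprod_meetC : commutative meet.
Proof. by move=> x y; apply: functional_extensionality_dep => i; apply: meetC. Qed.
Fact hprod_joinC : commutative join.
Proof. by move=> x y; apply: functional_extensionality_dep => i; apply: joinC. Qed.
Fact hprod_meetA : associative meet.
Proof. by move=> x y z; apply: functional_extensionality_dep => i; apply: meetA. Qed.
Fact hprod_joinA : associative join.
Proof. by move=> x y z; apply: functional_extensionality_dep => i; apply: joinA. Qed.
Fact hprod_joinKI y x : meet x (join x y) = x.
Proof. by apply: functional_extensionality_dep => i; apply: joinKI. Qed.
Fact hprod_meetKU y x : join x (meet x y) = x.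
Proof. by apply: functional_extensionality_dep => i; apply: meetKU. Qed.
Fact hprod_meetUl : left_distributive meet join.
Proof. by move=> x y z; apply: functional_extensionality_dep => i; apply: meetUl. Qed.
Fact hprod_meetxx : idempotent_op meet.
Proof. by move=> x; apply: functional_extensionality_dep => i; apply: meetxx. Qed.

HB.instance Definition _ := Order.isMeetJoinDistrLattice.Build
  (Order.Disp tt tt) hprod hprod_le_def (fun _ _ => erefl)
  hprod_meetC hprod_joinC hprod_meetA hprod_joinA hprod_joinKI hprod_meetKU
  hprod_meetUl hprod_meetxx.

Fact hprod_le0x x : ((fun i => \bot) : hprod) <= x.
Proof. by apply/asboolP => i; apply: le0x. Qed.
HB.instance Definition _ :=
  Order.hasBottom.Build (Order.Disp tt tt) hprod hprod_le0x.

Fact hprod_lex1 x : x <= ((fun i => \top) : hprod).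
Proof. by apply/asboolP => i; apply: lex1. Qed.
HB.instance Definition _ :=
  Order.hasTop.Build (Order.Disp tt tt) hprod hprod_lex1.

Fact hprod_himpP x y z :
  (x <= ((fun i => himp (y i) (z i)) : hprod)) = (x `&` y <= z).
Proof. by apply/asboolP/asboolP => h i; move: (h i); rewrite himpP. Qed.
HB.instance Definition _ :=
  isHeyting.Build (Order.Disp tt tt) hprod hprod_himpP.

End Product.

(** ** Varieties *)

Inductive hterm :=
  | HVar of nat
  | HBot
  | HTop
  | HMeet of hterm & hterm
  | HJoin of hterm & hterm
  | HImp of hterm & hterm.

Fixpoint heval d (A : heytingType d) (e : nat -> A) (t : hterm) : A :=
  match t with
  | HVar i => e i
  | HBot => \bot
  | HTop => \top
  | HMeet s t => heval e s `&` heval e t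
  | HJoin s t => heval e s `|` heval e t
  | HImp s t => himp (heval e s) (heval e t)
  end.

(* A variety is given by a set of equations; its members are the Heyting
   algebras that satisfy all of them. *)
Definition variety := hterm -> hterm -> Prop.

Definition in_variety (V : variety) d (A : heytingType d) : Prop :=
  forall s t, V s t -> forall e : nat -> A, heval e s = heval e t.

Definition free_on (V : variety) (X : Type) (F : heytAlg) (g : X -> F) : Prop :=
  in_variety V F /\
  forall B : heytAlg, in_variety V B -> forall a : X -> B,
    exists! f : {hmorphism F -> B}, f \o g =1 a.

Definition finitely_approximable (V : variety) : Prop :=
  forall (n : nat) (F : heytAlg) (g : 'I_n -> F), free_on V g ->
    exists (I : Type) (A : I -> finHeytAlg),
      (forall i, in_variety V (A i)) /\
      exists f : {hmorphism F -> hprod (fun i => heytAlg_of_fin (A i))},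
        injective f.

Definition lattice_free_on (V : variety) d (D : tbDistrLatticeType d)
    (F : heytAlg) (g : {bdlmorphism D -> F}) : Prop :=
  in_variety V F /\
  forall B : heytAlg, in_variety V B -> forall a : {bdlmorphism D -> B},
    exists! f : {hmorphism F -> B}, f \o g =1 a.

(** * The Heyting algebra of downsets *)

Section Downset.
Variables (d : Order.disp_t) (P : finPOrderType d).

Definition downclosed (A : {set P}) : bool :=
  [forall x in A, forall y, (y <= x) ==> (y \in A)].

Lemma downclosedP (A : {set P}) :
  reflect (forall x y, x \in A -> y <= x -> y \in A) (downclosed A).
Proof.
apply: (iffP forall_inP) => [h x y xA yx|h x xA].
  by have /forallP/(_ y)/implyP := h x xA; apply.
by apply/forallP => y; apply/implyP; apply: h.
Qed.

Record downset := Downset { dset :> {set P}; _ : downclosed dset }.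

HB.instance Definition _ := [isSub for dset].
HB.instance Definition _ := [Finite of downset by <:].

Implicit Types A B C : downset.

Lemma mem_downset A x y : x \in dset A -> y <= x -> y \in dset A.
Proof. by case: A => A /= /downclosedP; apply. Qed.

Fact downsetI_subproof A B : downclosed (dset A :&: dset B).
Proof.
apply/downclosedP => x y; rewrite !inE => /andP[xA xB] yx.
by rewrite (mem_downset xA yx) (mem_downset xB yx).
Qed.
Definition downsetI A B := Downset (downsetI_subproof A B).

Fact downsetU_subproof A B : downclosed (dset A :|: dset B).
Proof.
apply/downclosedP => x y; rewrite !inE => /orP[xA|xB] yx.
  by rewrite (mem_downset xA yx).
by rewrite (mem_downset xB yx) orbT.
Qed.
Definition downsetU A B := Downset (downsetU_subproof A B).

Fact downset0_subproof : downclosed set0.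
Proof. by apply/downclosedP => x y; rewrite inE. Qed.
Definition downset0 := Downset downset0_subproof.

Fact downsetT_subproof : downclosed setT.
Proof. by apply/downclosedP => x y; rewrite !inE. Qed.
Definition downsetT := Downset downsetT_subproof.

Fact downset_imp_subproof A B :
  downclosed [set p | [forall q in dset A, (q <= p) ==> (q \in dset B)]].
Proof.
apply/downclosedP => x y; rewrite !inE => /forall_inP h yx.
apply/forall_inP => q qA; apply/implyP => qy.
by have /implyP := h q qA; apply; apply: le_trans yx.
Qed.
Definition downset_imp A B := Downset (downset_imp_subproof A B).

Let le A B := dset A \subset dset B.
Let lt A B := (B != A) && le A B.

Fact downset_le_def A B : le A B = (downsetI A B == A).
Proof. by rewrite -val_eqE /=; apply/setIidPl/eqP. Qed.
Fact downsetIC : commutative downsetI.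
Proof. by move=> A B; apply/val_inj/setIC. Qed.
Fact downsetUC : commutative downsetU.
Proof. by move=> A B; apply/val_inj/setUC. Qed.
Fact downsetIA : associative downsetI.
Proof. by move=> A B C; apply/val_inj/setIA. Qed.
Fact downsetUA : associative downsetU.
Proof. by move=> A B C; apply/val_inj/setUA. Qed.
Fact downsetUKI B A : downsetI A (downsetU A B) = A.
Proof. by apply/val_inj; rewrite /= setUC setKU. Qed.
Fact downsetIKU B A : downsetU A (downsetI A B) = A.
Proof. by apply/val_inj; rewrite /= setIC setKI. Qed.
Fact downsetIUl : left_distributive downsetI downsetU.
Proof. by move=> A B C; apply/val_inj/setIUl. Qed.
Fact downsetII : idempotent_op downsetI.
Proof. by move=> A; apply/val_inj/setIid. Qed.

HB.instance Definition _ := Order.isMeetJoinDistrLattice.Build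
  (Order.Disp tt tt) downset downset_le_def (fun _ _ => erefl)
  downsetIC downsetUC downsetIA downsetUA downsetUKI downsetIKU
  downsetIUl downsetII.

Fact downset_le0x A : downset0 <= A.
Proof. exact: sub0set. Qed.
HB.instance Definition _ :=
  Order.hasBottom.Build (Order.Disp tt tt) downset downset_le0x.

Fact downset_lex1 A : A <= downsetT.
Proof. exact: subsetT. Qed.
HB.instance Definition _ :=
  Order.hasTop.Build (Order.Disp tt tt) downset downset_lex1.

Fact downset_impP A B C : (A <= downset_imp B C) = (A `&` B <= C).
Proof.
apply/subsetP/subsetP => h p.
  rewrite inE => /andP[/h]; rewrite inE => /forall_inP hp pB.
  by have /implyP := hp p pB; apply.
move=> pA; rewrite inE; apply/forall_inP => q qB; apply/implyP => qp.
by apply: h; rewrite inE qB andbT (mem_downset pA).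
Qed.
HB.instance Definition _ :=
  isHeyting.Build (Order.Disp tt tt) downset downset_impP.

End Downset.

Arguments downset {d} P.

(** * Finite rooted posets and open maps *)

(* A finite rooted poset is a finTPOrderType, with root \top. *)

Section Down.
Variables (d : Order.disp_t) (P : finPOrderType d) (p : P).

Definition down := {q : P | q <= p}.

HB.instance Definition _ := Finite.on down.
HB.instance Definition _ := SubType.on down.
HB.instance Definition _ := [SubChoice_isSubPOrder of down by <: with d].

Fact down_lex1 (x : down) : x <= (exist _ p (lexx p) : down).
Proof. exact: (valP x). Qed.
HB.instance Definition _ := Order.hasTop.Build d down down_lex1.

End Down.

Section OmorphismExt.
Variables (d : Order.disp_t) (P : porderType d).
Variables (d' : Order.disp_t) (L : porderType d').

Lemma omorphism_ext (u v : {omorphism P -> L}) : u =1 v -> u = v.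
Proof.
case: u v => u cu [v cv] /= /funext uv; case: v / uv cv => cv.
by case: cu cv => [[?]] [[?]]; do 3 f_equal; apply: Prop_irrelevance.
Qed.
End OmorphismExt.

(* The L-evaluations on P are the order-preserving maps P -> L; [eval_at u p]
   is the evaluation u_p. *)
Definition eval_at d (P : finPOrderType d) d' (L : finPOrderType d')
    (u : {omorphism P -> L}) (p : P) : {omorphism down p -> L} :=
  u \o (val : down p -> P).

(* [bisim n u v] is u ~_n v. *)
Fixpoint bisim d (L : finPOrderType d) (n : nat)
    d1 (P : finTPOrderType d1) d2 (Q : finTPOrderType d2)
    (u : {omorphism P -> L}) (v : {omorphism Q -> L}) {struct n} : Prop :=
  match n with
  | 0 => u \top = v \top
  | n'.+1 =>
      (forall p : P, exists q : Q, bisim n' (eval_at u p) (eval_at v q)) /\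
      (forall q : Q, exists p : P, bisim n' (eval_at u p) (eval_at v q))
  end.

Record openMap d (Q : finPOrderType d) d' (P : finPOrderType d') := OpenMap {
  open_map :> {omorphism Q -> P};
  open_mapP : forall (q : Q) (p' : P), p' <= open_map q ->
    exists2 q' : Q, q' <= q & open_map q' = p' }.

Lemma openMap_ext d (Q : finPOrderType d) d' (P : finPOrderType d')
  (f g : openMap Q P) : f =1 g -> f = g.
Proof.
case: f g => f fP [g gP] /= /omorphism_ext fg; case: g / fg gP => gP.
by f_equal; apply: Prop_irrelevance.
Qed.

Fact open_id_subproof d (P : finPOrderType d) (q p' : P) :
  p' <= idfun q -> exists2 q' : P, q' <= q & idfun q' = p'.
Proof. by exists p'. Qed.
Definition open_id d (P : finPOrderType d) : openMap P P :=
  OpenMap (@open_id_subproof d P).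

Fact open_comp_subproof d (R : finPOrderType d) d' (Q : finPOrderType d')
  d'' (P : finPOrderType d'') (g : openMap Q P) (f : openMap R Q) (q : R) p' :
  p' <= (g \o f) q -> exists2 q' : R, q' <= q & (g \o f) q' = p'.
Proof.
move=> /= /open_mapP[q' /open_mapP[r rq <-] <-].
by exists r.
Qed.
Definition open_comp d (R : finPOrderType d) d' (Q : finPOrderType d')
    d'' (P : finPOrderType d'') (g : openMap Q P) (f : openMap R Q) :
    openMap R P :=
  OpenMap (@open_comp_subproof _ R _ Q _ P g f).

Section DownOpen.
Variables (d : Order.disp_t) (P : finPOrderType d) (p : P).

Fact down_open_subproof (q : down p) (p' : P) : p' <= val q ->
  exists2 q' : down p, q' <= q & val q' = p'.
Proof.
move=> p'q; have p'p : p' <= p := le_trans p'q (valP q).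
by exists (exist _ p' p'p).
Qed.
Definition down_open : openMap (down p) P := OpenMap down_open_subproof.

Fact down_trace_subproof (A : downset P) :
  downclosed [set q : down p | val q \in dset A].
Proof.
by apply/downclosedP => x y; rewrite !inE => xA yx; apply: mem_downset xA yx.
Qed.
Definition down_trace (A : downset P) : downset (down p) :=
  Downset (down_trace_subproof A).

Fact down_image_subproof (B : downset (down p)) :
  downclosed [set val q | q : down p in dset B].
Proof.
apply/downclosedP => x y /imsetP[q qB ->] yq.
have yp : y <= p := le_trans yq (valP q).
by apply/imsetP; exists (exist _ y yp) => //; apply: (mem_downset qB).
Qed.
Definition down_image (B : downset (down p)) : downset P :=
  Downset (down_image_subproof B).

Lemma down_imageK : cancel down_image down_trace.
Proof.
move=> B; apply/val_inj/setP => q; rewrite inE /=.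
by rewrite mem_imset //; apply: val_inj.
Qed.

Lemma heval_down_trace (e : nat -> downset P) t :
  down_trace (heval e t) = heval (down_trace \o e) t.
Proof.
elim: t => //= [||s <- t <-|s <- t <-|s <- t <-]; apply/val_inj/setP => q.
- by rewrite !inE.
- by rewrite !inE.
- by rewrite !inE.
- by rewrite !inE.
rewrite !inE; apply/forall_inP/forall_inP => h r; last first.
  move=> rA; apply/implyP => rq.
  have rp : r <= p := le_trans rq (valP q).
  have /h /implyP : exist _ r rp \in dset (down_trace (heval e s)) by rewrite inE.
  by rewrite inE; apply.
by rewrite !inE => /h /implyP h'; apply/implyP => rq; apply: h'.
Qed.

Lemma down_in_variety V : in_variety V (downset P) ->
  in_variety V (downset (down p)).
Proof.
move=> VP s t Vst e.
have -> : e = down_trace \o (down_image \o e).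
  by apply: functional_extensionality_dep => i /=; rewrite down_imageK.
by rewrite -!heval_down_trace (VP s t Vst).
Qed.

End DownOpen.

(** * Categories *)

Record category := Category {
  obj :> Type;
  hom : obj -> obj -> Type;
  idm : forall a, hom a a;
  comp : forall a b c, hom b c -> hom a b -> hom a c;
  comp1m : forall a b (f : hom a b), comp (idm b) f = f;
  compm1 : forall a b (f : hom a b), comp f (idm a) = f;
  compA : forall a b c d (f : hom c d) (g : hom b c) (h : hom a b),
    comp f (comp g h) = comp (comp f g) h }.

Definition opposite (C : category) : category :=
  @Category C (fun a b => hom b a) (fun a => idm a) (fun a b c f g => comp g f)
    (fun a b f => compm1 f) (fun a b f => comp1m f)
    (fun a b c d f g h => esym (compA h g f)).

Definition full_subcategory (C : category) (S : C -> Prop) : category :=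
  @Category {a : C | S a} (fun a b => hom (sval a) (sval b))
    (fun a => idm (sval a)) (fun a b c => @comp C _ _ _)
    (fun a b => @comp1m C _ _) (fun a b => @compm1 C _ _)
    (fun a b c d => @compA C _ _ _ _).

Record functor (C D : category) := Functor {
  fobj :> C -> D;
  fmap : forall a b, hom a b -> hom (fobj a) (fobj b);
  fmap1 : forall a, fmap (idm a) = idm (fobj a);
  fmapM : forall a b c (f : hom b c) (g : hom a b),
    fmap (comp f g) = comp (fmap f) (fmap g) }.

Definition functor_id (C : category) : functor C C :=
  @Functor C C id (fun a b => id) (fun a => erefl) (fun a b c f g => erefl).

Fact functor_comp1 (C D E : category) (G : functor D E) (F : functor C D) a :
  fmap G (fmap F (idm a)) = idm (G (F a)).
Proof. by rewrite !fmap1. Qed.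
Fact functor_compM (C D E : category) (G : functor D E) (F : functor C D)
  a b c (f : hom b c) (g : hom a b) :
  fmap G (fmap F (comp f g)) = comp (fmap G (fmap F f)) (fmap G (fmap F g)).
Proof. by rewrite !fmapM. Qed.
Definition functor_comp (C D E : category) (G : functor D E) (F : functor C D) :
    functor C E :=
  @Functor C E (fun a => G (F a)) (fun a b f => fmap G (fmap F f))
    (functor_comp1 G F) (@functor_compM _ _ _ G F).

Record natural (C D : category) (F G : functor C D) := Natural {
  ncomp :> forall a, hom (F a) (G a);
  naturality : forall a b (f : hom a b),
    comp (ncomp b) (fmap F f) = comp (fmap G f) (ncomp a) }.

Lemma natural_ext (C D : category) (F G : functor C D) (s t : natural F G) :
  (forall a, s a = t a) -> s = t.
Proof.
case: s t => s sP [t tP] /= st.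
have {}st : s = t by apply: functional_extensionality_dep.
by case: t / st tP => tP; f_equal; apply: Prop_irrelevance.
Qed.

Fact natural_id_subproof (C D : category) (F : functor C D) a b (f : hom a b) :
  comp (idm (F b)) (fmap F f) = comp (fmap F f) (idm (F a)).
Proof. by rewrite comp1m compm1. Qed.
Definition natural_id (C D : category) (F : functor C D) : natural F F :=
  Natural (@natural_id_subproof C D F).

Fact natural_comp_subproof (C D : category) (F G H : functor C D)
  (t : natural G H) (s : natural F G) a b (f : hom a b) :
  comp (comp (t b) (s b)) (fmap F f) = comp (fmap H f) (comp (t a) (s a)).
Proof. by rewrite -compA naturality compA naturality compA. Qed.
Definition natural_comp (C D : category) (F G H : functor C D)
    (t : natural G H) (s : natural F G) : natural F H :=
  Natural (natural_comp_subproof t s).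

Definition isomorphism (C : category) (a b : C) (f : hom a b) : Prop :=
  exists g : hom b a, comp g f = idm a /\ comp f g = idm b.

Definition naturally_isomorphic (C D : category) (F G : functor C D) : Prop :=
  exists s : natural F G, forall a, isomorphism (s a).

Definition equivalent (C D : category) : Prop :=
  exists (F : functor C D) (G : functor D C),
    naturally_isomorphic (functor_id C) (functor_comp G F) /\
    naturally_isomorphic (functor_comp F G) (functor_id D).

Definition dual (C D : category) : Prop := equivalent C (opposite D).

Definition typeCat : category :=
  @Category Type (fun A B => A -> B) (fun A => @idfun A)
    (fun A B C f g => f \o g) (fun A B f => erefl) (fun A B f => erefl)
    (fun A B C D f g h => erefl).

Definition presheaf (C : category) := functor (opposite C) typeCat.

(** * The category HD *)

Definition heyting_category : category.
Proof.
refine (@Category heytAlg (fun A B => {hmorphism A -> B}) (fun A => idfun)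
  (fun A B C f g => f \o g) _ _ _); by move=> *; apply: hmorphism_ext.
Defined.

Definition HD (V : variety) : category :=
  full_subcategory (C := heyting_category) (fun A =>
    exists d (D : finTBDistrLatticeType d) (g : {bdlmorphism D -> A}),
      lattice_free_on V g).

(** * The category M_H *)

Record finPoset := FinPoset {
  fposet_disp : Order.disp_t;
  fposet_sort :> finPOrderType fposet_disp }.

Record rootedPoset := RootedPoset {
  rposet_disp : Order.disp_t;
  rposet_sort :> finTPOrderType rposet_disp }.

Definition rooted_category : category.
Proof.
refine (@Category rootedPoset (fun Q P => openMap Q P) (fun P => open_id P)
  (fun R Q P f g => open_comp f g) _ _ _); by move=> *; apply: openMap_ext.
Defined.

Definition P0 (V : variety) : category :=
  full_subcategory (C := rooted_category) (fun P => in_variety V (downset P)).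

Section Evaluations.
Variable V : variety.

Definition evaluations (L : finPoset) : presheaf (P0 V).
Proof.
refine (@Functor (opposite (P0 V)) typeCat
  (fun P : P0 V => {omorphism sval P -> L})
  (fun P Q (h : openMap (sval Q) (sval P)) u => u \o h) _ _).
- by move=> P /=; apply: functional_extensionality_dep => u; apply: omorphism_ext.
- by move=> P Q R g h; apply: functional_extensionality_dep => u;
    apply: omorphism_ext.
Defined.

Definition has_b_index (L M : finPoset)
    (f : natural (evaluations L) (evaluations M)) (n : nat) : Prop :=
  forall (P Q : P0 V) (u : {omorphism sval P -> L}) (v : {omorphism sval Q -> L}),
    bisim n u v -> bisim 0 (f P u) (f Q v).

Definition down_P0 (P : P0 V) (p : sval P) : P0 V :=
  exist _ (RootedPoset (down p)) (@down_in_variety _ _ p _ (svalP P)).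

Lemma b_index_id L : has_b_index (natural_id (evaluations L)) 0.
Proof. by []. Qed.

Lemma natural_eval_at (L M : finPoset)
    (f : natural (evaluations L) (evaluations M))
    (P : P0 V) (u : {omorphism sval P -> L}) (p : sval P) :
  eval_at (f P u) p = f (down_P0 p) (eval_at u p).
Proof.
have /(congr1 (fun h => h u)) fu :=
  @naturality _ _ _ _ f P (down_P0 p) (down_open p).
have -> : eval_at u p = u \o down_open p :> {omorphism down p -> L}.
  exact: omorphism_ext.
have -> : eval_at (f P u) p = f P u \o down_open p :> {omorphism down p -> M}.
  exact: omorphism_ext.
exact: esym fu.
Qed.

Lemma b_index_shift (L M : finPoset)
    (f : natural (evaluations L) (evaluations M)) k : has_b_index f k ->
  forall n (P Q : P0 V) (u : {omorphism sval P -> L})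
    (v : {omorphism sval Q -> L}),
  bisim (n + k) u v -> bisim n (f P u) (f Q v).
Proof.
move=> fk; elim=> [|n IHn] P Q u v; first exact: fk.
move=> [uv vu]; split=> [p|q].
- have [q pq] := uv p; exists q; rewrite !natural_eval_at.
  exact: (IHn (down_P0 p) (down_P0 q)).
- have [p pq] := vu q; exists p; rewrite !natural_eval_at.
  exact: (IHn (down_P0 p) (down_P0 q)).
Qed.

Lemma b_index_comp (L M N : finPoset)
    (g : natural (evaluations M) (evaluations N))
    (f : natural (evaluations L) (evaluations M)) m k :
  has_b_index g m -> has_b_index f k ->
  has_b_index (natural_comp g f) (m + k).
Proof. by move=> gm fk P Q u v /(b_index_shift fk); apply: gm. Qed.

Definition MH_hom (L M : finPoset) :=
  {f : natural (evaluations L) (evaluations M) | exists n, has_b_index f n}.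

Definition MH_id (L : finPoset) : MH_hom L L :=
  exist _ (natural_id (evaluations L)) (ex_intro _ 0 (@b_index_id L)).

Fact MH_comp_subproof (L M N : finPoset) (g : MH_hom M N) (f : MH_hom L M) :
  exists n, has_b_index (natural_comp (sval g) (sval f)) n.
Proof.
have [m gm] := svalP g; have [k fk] := svalP f.
by exists (m + k); apply: b_index_comp.
Qed.
Definition MH_comp (L M N : finPoset) (g : MH_hom M N) (f : MH_hom L M) :
    MH_hom L N :=
  exist _ (natural_comp (sval g) (sval f)) (MH_comp_subproof g f).

Lemma MH_hom_ext (L M : finPoset) (f g : MH_hom L M) :
  (forall P u, sval f P u = sval g P u) -> f = g.
Proof.
case: f g => f fP [g gP] /= fg.
have {}fg : f = g.
  by apply: natural_ext => P; exact: (functional_extensionality_dep (fg P)).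
by case: g / fg gP => gP; f_equal; apply: Prop_irrelevance.
Qed.

End Evaluations.

(* The object h_L is represented by the finite poset L. *)
Definition MH (V : variety) : category.
Proof.
refine (@Category finPoset (MH_hom V) (MH_id V) (@MH_comp V) _ _ _);
  by move=> *; apply: MH_hom_ext.
Defined.

(* Main.v *)
(* A [V]-algebra free on the downset lattice of [L] is an algebra of terms.
   Its homomorphisms to the algebra of downsets of [P] are the [L]-evaluations on
   [P], and by finite approximability these separate its elements when [P] ranges
   over [P0 V]: a failing inequality between terms, relativized to the finitely
   many lattice relations, is refuted in a finite algebra, hence below a join
   prime of that algebra, where the relations hold.  A homomorphism of free
   algebras therefore amounts to a natural transformation of evaluations; it has a
   b-index because membership in the value of a term of implication depth [n] is
   invariant under ~_n.  Conversely ~_n has finitely many classes, each described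
   by characteristic terms, so a transformation with b-index [n] maps each
   generator to a term. *)

From HB Require Import structures.
From mathcomp Require Import all_boot all_order.
From mathcomp Require Import boolp.
Require Import Defs.

Set Implicit Arguments.
Unset Strict Implicit.
Unset Printing Implicit Defensive.

Import Order.Theory.
Local Open Scope order_scope.

(** * Equivalences from fully faithful, essentially surjective functors *)

(** A quasi-inverse is built by choice: [K c] is an object whose image is isomorphic to [c] along
    [i c]; a morphism is conjugated by these isomorphisms and lifted through [G]. *)
Lemma ff_essentially_surjective_equivalent (C D : category) (G : functor D C) :
  (forall a b (h : hom (G a) (G b)), exists! f : hom a b, fmap G f = h) ->
  (forall c : C, exists (d : D) (i : hom c (G d)), isomorphism i) ->
  equivalent C D.
Proof.
move=> ff es.
pose K c := projT1 (cid (es c)).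
pose i c : hom c (G (K c)) := projT1 (cid (projT2 (cid (es c)))).
have iP c : isomorphism (i c) := projT2 (cid (projT2 (cid (es c)))).
pose j c : hom (G (K c)) c := projT1 (cid (iP c)).
have jK c : comp (j c) (i c) = idm c := proj1 (projT2 (cid (iP c))).
have iK c : comp (i c) (j c) = idm _ := proj2 (projT2 (cid (iP c))).
pose lift a b (h : hom (G a) (G b)) : hom a b := projT1 (cid (ff a b h)).
have liftK a b (h : hom (G a) (G b)) : fmap G (lift a b h) = h.
  exact: proj1 (projT2 (cid (ff a b h))).
have fmap_inj a b (f g : hom a b) : fmap G f = fmap G g -> f = g.
  move=> fg; have [k [_ ku]] := ff a b (fmap G g).
  by rewrite -(ku f fg) (ku g erefl).
pose Fm a b (f : hom a b) := lift _ _ (comp (i b) (comp f (j a))).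
have F1 a : Fm a a (idm a) = idm (K a).
  by apply: fmap_inj; rewrite liftK comp1m iK fmap1.
have FM a b c (f : hom b c) (g : hom a b) :
    Fm _ _ (comp f g) = comp (Fm _ _ f) (Fm _ _ g).
  apply: fmap_inj; rewrite fmapM !liftK -!compA.
  by congr comp; congr comp; rewrite !compA jK comp1m.
pose F : functor C D := Functor F1 FM.
exists F, G; split.
  have nat a b (f : hom a b) :
      comp (i b) (fmap (functor_id C) f) =
      comp (fmap (functor_comp G F) f) (i a).
    by rewrite /= liftK -!compA jK compm1.
  by exists (@Natural _ _ (functor_id C) (functor_comp G F) i nat).
(* The counit is the lift of the inverse [j]; identities between lifts are checked after applying
   the faithful [G]. *)
have nat a b (f : hom a b) :
    comp (lift _ _ (j (G b))) (fmap (functor_comp F G) f) =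
    comp (fmap (functor_id D) f) (lift _ _ (j (G a))).
  by apply: fmap_inj; rewrite !fmapM /= !liftK compA jK comp1m.
exists (@Natural _ _ (functor_comp F G) (functor_id D) (fun b => lift _ _ (j (G b))) nat) => a.
exists (lift _ _ (i (G a))); split; apply: fmap_inj.
  by rewrite fmapM /= !liftK iK fmap1.
by rewrite fmapM /= !liftK jK fmap1.
Qed.

(** * Morphisms from equations *)

Section BuildBdlmorphism.
Variables (d : Order.disp_t) (A : tbLatticeType d).
Variables (d' : Order.disp_t) (B : tbLatticeType d') (f : A -> B).
Hypotheses (fI : {morph f : x y / x `&` y}) (fU : {morph f : x y / x `|` y}).
Hypotheses (f0 : f \bot = \bot) (f1 : f \top = \top).

Let g of {morph f : x y / x `&` y} & {morph f : x y / x `|` y}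
  & f \bot = \bot & f \top = \top := f.
Let h := g fI fU f0 f1.

Fact meet_morphism_homo : {homo h : x y / x <= y}.
Proof. by move=> x y /meet_idPl xy; apply/meet_idPl; have := fI x y; rewrite xy. Qed.
HB.instance Definition _ := Order.isOrderMorphism.Build _ _ _ _ h meet_morphism_homo.
HB.instance Definition _ := Order.isMeetLatticeMorphism.Build _ _ _ _ h fI.
HB.instance Definition _ := Order.isJoinLatticeMorphism.Build _ _ _ _ h fU.
HB.instance Definition _ := Order.isBLatticeMorphism.Build _ _ _ _ h f0.
HB.instance Definition _ := Order.isTLatticeMorphism.Build _ _ _ _ h f1.
Definition bdlmorphism_of : {bdlmorphism A -> B} := h.

End BuildBdlmorphism.

Section BuildHmorphism.
Variables (d : Order.disp_t) (A : heytingType d).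
Variables (d' : Order.disp_t) (B : heytingType d') (f : {bdlmorphism A -> B}).
Hypothesis (fX : {morph f : x y / himp x y}).

Let g of {morph f : x y / himp x y} : A -> B := f.
HB.instance Definition _ := BoundedLatticeMorphism.on (g fX).
HB.instance Definition _ := isHeytingMorphism.Build _ _ _ _ (g fX) fX.
Definition hmorphism_of : {hmorphism A -> B} := g fX.
End BuildHmorphism.

Definition bdl_comp d (A : tbLatticeType d) d' (B : tbLatticeType d')
  d'' (C : tbLatticeType d'') (f : {bdlmorphism B -> C}) (g : {bdlmorphism A -> B}) :
  {bdlmorphism A -> C}.
Proof.
apply: (@bdlmorphism_of _ _ _ _ (f \o g)) => [x y|x y||] /=.
- by rewrite !omorphI.
- by rewrite !omorphU.
- by rewrite !omorph0.
- by rewrite !omorph1.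
Defined.

Lemma injective_hmorphism_le d (A : heytingType d) d' (B : heytingType d')
  (f : {hmorphism A -> B}) : injective f -> forall x y, (f x <= f y) = (x <= y).
Proof.
move=> fi x y; apply/idP/idP => [/meet_idPl|/omorph_le//].
by rewrite -omorphI => /fi /meet_idPl.
Qed.

Lemma heval_hmorphism d (A : heytingType d) d' (B : heytingType d')
  (f : {hmorphism A -> B}) (e : nat -> A) t :
  f (heval e t) = heval (f \o e) t.
Proof.
elim: t => //= [||s <- t <-|s <- t <-|s <- t <-].
- exact: omorph0.
- exact: omorph1.
- exact: omorphI.
- exact: omorphU.
- exact: hmorphX.
Qed.

Lemma heval_ext d (A : heytingType d) (e e' : nat -> A) t :
  e =1 e' -> heval e t = heval e' t.
Proof. by move=> /funext ->. Qed.

Fixpoint hsubst (sigma : nat -> hterm) (t : hterm) : hterm :=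
  match t with
  | HVar i => sigma i
  | HBot => HBot
  | HTop => HTop
  | HMeet s t => HMeet (hsubst sigma s) (hsubst sigma t)
  | HJoin s t => HJoin (hsubst sigma s) (hsubst sigma t)
  | HImp s t => HImp (hsubst sigma s) (hsubst sigma t)
  end.

Lemma heval_hsubst d (A : heytingType d) (e : nat -> A) sigma t :
  heval e (hsubst sigma t) = heval (heval e \o sigma) t.
Proof. by elim: t => //= s -> t ->. Qed.

Lemma heval_prod I (A : I -> heytAlg) (e : nat -> hprod A) t i :
  heval e t i = heval (fun k => e k i) t.
Proof. by elim: t => //= s <- t <-. Qed.

(** * Algebras presented by generators and relations *)

(** A condition on valuations rather than a set of equations: it selects, in each algebra, the
    assignments of the generators that respect the relations. *)
Definition presentation := forall B : heytAlg, (nat -> B) -> Prop.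

Section TermAlgebra.
Variables (V : variety) (K : presentation).

(** Semantic consequence replaces derivability, so no proof calculus is required. *)
Definition teq (s t : hterm) : Prop :=
  forall B : heytAlg, in_variety V B -> forall e : nat -> B, K e ->
    heval e s = heval e t.

(** The quotient of terms by [teq], a class being the predicate that [teq] gives at one of its
    members. *)
Definition talg := {C : hterm -> Prop | exists t, C = teq t}.

HB.instance Definition _ := gen_eqMixin talg.
HB.instance Definition _ := gen_choiceMixin talg.

Definition tclass (t : hterm) : talg := exist _ (teq t) (ex_intro _ t erefl).
Definition trepr (x : talg) : hterm := projT1 (cid (svalP x)).

Lemma talg_inj (x y : talg) : sval x = sval y -> x = y.
Proof. by case: x y => [x Px] [y Py] /= xy; apply: eq_exist. Qed.

Lemma teq_sym s t : teq s t -> teq t s.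
Proof. by move=> st B VB e Ke; rewrite (st B VB e Ke). Qed.

Lemma teq_trans s t u : teq s t -> teq t u -> teq s u.
Proof. by move=> st tu B VB e Ke; rewrite (st B VB e Ke) (tu B VB e Ke). Qed.

Lemma tclassP s t : tclass s = tclass t <-> teq s t.
Proof.
split=> [[st]|st]; first by rewrite st.
apply: talg_inj; apply/funext => u; apply/propext; split.
  exact: teq_trans (teq_sym st).
exact: teq_trans st.
Qed.

Lemma treprK x : tclass (trepr x) = x.
Proof. by apply: talg_inj; rewrite /trepr; case: cid. Qed.

Section Evaluation.
Variables (B : heytAlg) (VB : in_variety V B) (e : nat -> B) (Ke : K e).

Definition teval_fun (x : talg) : B := heval e (trepr x).

Lemma teval_tclass t : teval_fun (tclass t) = heval e t.
Proof. by apply: (proj1 (tclassP _ _)) Ke => //; apply: treprK. Qed.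
End Evaluation.

Definition tlift2 (op : hterm -> hterm -> hterm) (x y : talg) : talg :=
  tclass (op (trepr x) (trepr y)).

(** Admissible valuations separate classes, so each law of the quotient is inherited from the
    algebras in [V]. *)
Lemma talgP (x y : talg) :
  (forall (B : heytAlg) (VB : in_variety V B) (e : nat -> B), K e ->
     teval_fun e x = teval_fun e y) -> x = y.
Proof. by move=> xy; rewrite -(treprK x) -(treprK y); apply/tclassP. Qed.

Let meet := tlift2 HMeet.
Let join := tlift2 HJoin.
Let le x y : bool := meet x y == x.

Let evI (B : heytAlg) (VB : in_variety V B) (e : nat -> B) (Ke : K e) x y :
  teval_fun e (meet x y) = teval_fun e x `&` teval_fun e y.
Proof. exact: teval_tclass. Qed.
Let evU (B : heytAlg) (VB : in_variety V B) (e : nat -> B) (Ke : K e) x y :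
  teval_fun e (join x y) = teval_fun e x `|` teval_fun e y.
Proof. exact: teval_tclass. Qed.

Let talg_leP x y :
  le x y <-> (forall (B : heytAlg) (VB : in_variety V B) (e : nat -> B), K e ->
     teval_fun e x <= teval_fun e y).
Proof.
split=> [/eqP xy B VB e Ke|xy].
  by apply/meet_idPl; rewrite -evI // xy.
by apply/eqP/talgP => B VB e Ke; rewrite evI //; apply/meet_idPl/xy.
Qed.

Fact talg_meetC : commutative meet.
Proof. by move=> x y; apply: talgP => B VB e Ke; rewrite !evI // meetC. Qed.
Fact talg_joinC : commutative join.
Proof. by move=> x y; apply: talgP => B VB e Ke; rewrite !evU // joinC. Qed.
Fact talg_meetA : associative meet.
Proof. by move=> x y z; apply: talgP => B VB e Ke; rewrite !evI // meetA. Qed.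
Fact talg_joinA : associative join.
Proof. by move=> x y z; apply: talgP => B VB e Ke; rewrite !evU // joinA. Qed.
Fact talg_joinKI y x : meet x (join x y) = x.
Proof. by apply: talgP => B VB e Ke; rewrite evI // evU // joinKI. Qed.
Fact talg_meetKU y x : join x (meet x y) = x.
Proof. by apply: talgP => B VB e Ke; rewrite evU // evI // meetKU. Qed.
Fact talg_meetUl : left_distributive meet join.
Proof.
by move=> x y z; apply: talgP => B VB e Ke; rewrite !(evU, evI) // meetUl.
Qed.
Fact talg_meetxx : idempotent_op meet.
Proof. by move=> x; apply: talgP => B VB e Ke; rewrite evI // meetxx. Qed.

HB.instance Definition _ := Order.isMeetJoinDistrLattice.Build
  (Order.Disp tt tt) talg (fun _ _ => erefl) (fun _ _ => erefl)
  talg_meetC talg_joinC talg_meetA talg_joinA talg_joinKI talg_meetKU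
  talg_meetUl talg_meetxx.

Fact talg_le0x (x : talg) : tclass HBot <= x.
Proof. by apply/talg_leP => B VB e Ke; rewrite teval_tclass //= le0x. Qed.
HB.instance Definition _ :=
  Order.hasBottom.Build (Order.Disp tt tt) talg talg_le0x.

Fact talg_lex1 (x : talg) : x <= tclass HTop.
Proof. by apply/talg_leP => B VB e Ke; rewrite teval_tclass //= lex1. Qed.
HB.instance Definition _ :=
  Order.hasTop.Build (Order.Disp tt tt) talg talg_lex1.

Fact talg_himpP (x y z : talg) : (x <= tlift2 HImp y z) = (x `&` y <= z).
Proof.
apply/idP/idP => /talg_leP h; apply/talg_leP => B VB e Ke; move: (h B VB e Ke);
  by rewrite evI // teval_tclass //= himpP.
Qed.
HB.instance Definition _ := isHeyting.Build (Order.Disp tt tt) talg talg_himpP.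

Definition term_algebra : heytAlg := HeytAlg talg.

Lemma heval_tclass (sigma : nat -> hterm) t :
  heval (tclass \o sigma : nat -> term_algebra) t = tclass (hsubst sigma t).
Proof.
by elim: t => //= s -> t ->; apply/tclassP => B VB e Ke /=;
  rewrite -![heval e (trepr _)]/(teval_fun e _) !teval_tclass.
Qed.

Lemma heval_trepr (e : nat -> term_algebra) t :
  heval e t = tclass (hsubst (trepr \o e) t).
Proof. by rewrite -heval_tclass; apply: heval_ext => i /=; rewrite treprK. Qed.

(** A valuation in the quotient amounts to a substitution, and evaluating a substituted term is
    evaluating the original term under another valuation, where the equations of [V] hold. *)
Lemma term_algebra_in_variety : in_variety V term_algebra.
Proof.
move=> s t Vst e; rewrite !heval_trepr; apply/tclassP => B VB e' Ke'.
by rewrite !heval_hsubst; apply: VB.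
Qed.

Section EvaluationMorphism.
Variables (B : heytAlg) (VB : in_variety V B) (e : nat -> B) (Ke : K e).

Definition teval_bdl : {bdlmorphism term_algebra -> B}.
Proof.
apply: (@bdlmorphism_of _ _ _ _ (teval_fun e : term_algebra -> B)).
- by move=> x y; apply: evI.
- by move=> x y; apply: evU.
- exact: teval_tclass.
- exact: teval_tclass.
Defined.

Fact teval_himp : {morph teval_bdl : x y / himp x y}.
Proof. by move=> x y; apply: teval_tclass. Qed.

Definition teval : {hmorphism term_algebra -> B} := hmorphism_of teval_himp.

Lemma tevalE t : teval (tclass t) = heval e t.
Proof. exact: teval_tclass. Qed.
End EvaluationMorphism.

Lemma term_algebra_ext (B : heytAlg) (f g : {hmorphism term_algebra -> B}) :
  (forall i, f (tclass (HVar i)) = g (tclass (HVar i))) -> f = g.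
Proof.
move=> fg; apply: hmorphism_ext => x; rewrite -(treprK x).
have -> : tclass (trepr x) = heval (fun i => tclass (HVar i) : term_algebra) (trepr x).
  rewrite (heval_tclass HVar); congr tclass.
  by elim: (trepr x) => //= s <- t <-.
by rewrite !heval_hmorphism; apply: heval_ext.
Qed.

End TermAlgebra.

(** * Finite distributive lattices as downset lattices *)

Section InverseBdlmorphism.
Variables (d : Order.disp_t) (A : tbLatticeType d).
Variables (d' : Order.disp_t) (B : tbLatticeType d').
Variables (f : {bdlmorphism A -> B}) (g : B -> A).
Hypotheses (fK : cancel f g) (gK : cancel g f).

Definition bdlmorphism_inv : {bdlmorphism B -> A}.
Proof.
apply: (@bdlmorphism_of _ _ _ _ g).
- by move=> x y; rewrite -{1}(gK x) -{1}(gK y) -omorphI fK.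
- by move=> x y; rewrite -{1}(gK x) -{1}(gK y) -omorphU fK.
- by rewrite -(omorph0 f) fK.
- by rewrite -(omorph1 f) fK.
Defined.

End InverseBdlmorphism.

(** Implication is determined by the order through its adjunction with meet, and a bijective lattice
    morphism reflects the order. *)
Lemma bijective_bdlmorphism_himp d (A : heytingType d) d' (B : heytingType d')
  (f : {bdlmorphism A -> B}) (g : B -> A) :
  cancel f g -> cancel g f -> {morph f : x y / himp x y}.
Proof.
move=> fK gK x y.
have f_le a b : (f a <= f b) = (a <= b).
  by rewrite !leEmeet -omorphI (can_eq fK).
suff le_imp z : (z <= f (himp x y)) = (z <= himp (f x) (f y)).
  by apply/le_anti; rewrite -le_imp lexx /= le_imp.
by rewrite -(gK z) f_le !himpP -omorphI f_le.
Qed.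

Lemma in_variety_surjection V d (A : heytingType d) d' (B : heytingType d')
  (f : {hmorphism A -> B}) (g : B -> A) :
  cancel g f -> in_variety V A -> in_variety V B.
Proof.
move=> gK VA s t Vst e.
have eE : f \o (g \o e) =1 e by move=> i /=; rewrite gK.
by rewrite -!(heval_ext _ eE) -!heval_hmorphism (VA _ _ Vst).
Qed.

Section Birkhoff.
Variables (d : Order.disp_t) (D : finTBDistrLatticeType d).

Definition join_prime (j : D) : bool :=
  (j != \bot) && [forall x, forall y, (j <= x `|` y) ==> (j <= x) || (j <= y)].

Definition join_primes := {j : D | join_prime j}.

HB.instance Definition _ := Finite.on join_primes.
HB.instance Definition _ := SubType.on join_primes.
HB.instance Definition _ := [SubChoice_isSubPOrder of join_primes by <: with d].

Lemma join_primeU (j : join_primes) x y :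
  (val j <= x `|` y) = (val j <= x) || (val j <= y).
Proof.
apply/idP/orP => [|[]]; last 2 first.
- by move=> h; apply: le_trans h (leUl _ _).
- by move=> h; apply: le_trans h (leUr _ _).
have /andP[_ /forallP/(_ x)/forallP/(_ y)/implyP h] := valP j.
by move=> /h /orP.
Qed.

Lemma join_prime0 (j : join_primes) : (val j <= \bot) = false.
Proof. by rewrite lex0; have /andP[/negbTE] := valP j. Qed.

(** An element minimal among those below [a] and not below [b] is join prime: if it lay below a join
    but below neither term of it, distributivity would split it into two strictly smaller parts,
    both below [b]. *)
Lemma join_primes_separate (a b : D) : ~~ (a <= b) ->
  exists2 j : join_primes, val j <= a & ~~ (val j <= b).
Proof.
move=> ab.
pose sep := [pred x | (x <= a) && ~~ (x <= b)].
have Pa : sep a by rewrite /= lexx.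
(* The number of elements below is strictly monotone, so minimizing it gives an order-minimal
   element. *)
case: (arg_minnP (fun x : D => #|[set y | y <= x]|) Pa) => m /andP[ma mb] m_min.
have below x : x < m -> x <= b.
  move=> xm; apply/negPn/negP => xb.
  have := m_min x; rewrite /= xb (le_trans (ltW xm) ma) => /(_ isT).
  rewrite leqNgt => /negP; apply; apply/proper_card/properP; split.
    by apply/subsetP => y; rewrite !inE => /le_trans; apply; apply: ltW.
  by exists m; rewrite !inE ?lexx // lt_geF.
have m_prime : join_prime m.
  apply/andP; split.
    by apply: contraNneq mb => ->; apply: le0x.
  apply/forallP => x; apply/forallP => y; apply/implyP => mxy.
  apply/negPn/negP; rewrite negb_or => /andP[mx my].
  move/negP: mb; apply.
  have -> : m = (m `&` x) `|` (m `&` y) by rewrite -meetUr; apply/esym/meet_idPl.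
  rewrite leUx !below // lt_neqAle leIl andbT.
    by apply: contraNneq my => <-; apply: leIr.
  by apply: contraNneq mx => <-; apply: leIr.
by exists (exist _ m m_prime).
Qed.

Fact join_primes_below_subproof (a : D) :
  downclosed [set j : join_primes | val j <= a].
Proof. by apply/downclosedP => x y; rewrite !inE => xa yx; apply: le_trans xa. Qed.
Definition join_primes_below (a : D) : downset join_primes :=
  Downset (join_primes_below_subproof a).

Definition birkhoff : {bdlmorphism D -> downset join_primes}.
Proof.
apply: (@bdlmorphism_of _ _ _ _ join_primes_below).
- by move=> x y; apply/val_inj/setP => j; rewrite !inE lexI.
- by move=> x y; apply/val_inj/setP => j; rewrite !inE join_primeU.
- by apply/val_inj/setP => j; rewrite !inE join_prime0.
- by apply/val_inj/setP => j; rewrite !inE lex1.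
Defined.

Lemma in_birkhoff a j : (j \in dset (birkhoff a)) = (val j <= a).
Proof. by rewrite inE. Qed.

Definition birkhoff_inv (U : downset join_primes) : D :=
  \join_(j in dset U) val j.

(** A join prime below a finite join is below one of its members, and [U] is closed downwards. *)
Lemma birkhoff_invK : cancel birkhoff_inv birkhoff.
Proof.
move=> U; apply/val_inj/setP => j; rewrite in_birkhoff.
apply/idP/idP => [|jU]; last exact: joins_sup.
apply: contraLR => jU; rewrite /birkhoff_inv.
elim/big_ind: _ => [|x y jx jy|i iU].
- by rewrite join_prime0.
- by rewrite join_primeU negb_or jx.
- by apply: contra jU => ji; apply: mem_downset iU _.
Qed.

Lemma birkhoff_inj : injective birkhoff.
Proof.
suff le_ab a b : birkhoff a = birkhoff b -> a <= b.
  by move=> a b ab; apply/le_anti; rewrite !le_ab.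
move=> ab; apply/negPn/negP => /join_primes_separate[j ja /negP]; apply.
by rewrite -in_birkhoff -ab in_birkhoff.
Qed.

Lemma birkhoffK : cancel birkhoff birkhoff_inv.
Proof. by move=> a; apply: birkhoff_inj; rewrite birkhoff_invK. Qed.

End Birkhoff.

(** * Evaluations as lattice morphisms between downset lattices *)

Section Preimage.
Variables (d : Order.disp_t) (P : finPOrderType d).
Variables (d' : Order.disp_t) (L : finPOrderType d').

Fact preim_downset_subproof (u : {omorphism P -> L}) (c : downset L) :
  downclosed [set p | u p \in dset c].
Proof.
apply/downclosedP => x y; rewrite !inE => uxc yx.
exact: mem_downset uxc (omorph_le u yx).
Qed.
Definition preim_downset u c : downset P := Downset (preim_downset_subproof u c).

Lemma in_preim_downset u c p : (p \in dset (preim_downset u c)) = (u p \in dset c).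
Proof. by rewrite inE. Qed.

Definition preim_bdl (u : {omorphism P -> L}) : {bdlmorphism downset L -> downset P}.
Proof.
by apply: (@bdlmorphism_of _ _ _ _ (preim_downset u)) => [x y|x y||];
  apply/val_inj/setP => p; rewrite !inE.
Defined.

Lemma in_preim_bdl u c p : (p \in dset (preim_bdl u c)) = (u p \in dset c).
Proof. exact: in_preim_downset. Qed.

Fact principal_subproof (l : L) : downclosed [set x | x <= l].
Proof. by apply/downclosedP => x y; rewrite !inE => xl yx; apply: le_trans xl. Qed.
Definition principal l : downset L := Downset (principal_subproof l).

Lemma in_principal l x : (x \in dset (principal l)) = (x <= l).
Proof. by rewrite inE. Qed.

Lemma principal_le l (c : downset L) : (principal l <= c) = (l \in dset c).
Proof.
apply/subsetP/idP => [|lc x]; first by apply; rewrite in_principal.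
by rewrite in_principal => /(mem_downset lc).
Qed.

Lemma downset_separated (x y : L) :
  (forall c : downset L, (x \in dset c) = (y \in dset c)) -> x = y.
Proof.
move=> xy; apply/le_anti/andP; split.
  by rewrite -in_principal xy in_principal.
by rewrite -in_principal -xy in_principal.
Qed.

Lemma preim_bdl_inj (u v : {omorphism P -> L}) :
  preim_bdl u =1 preim_bdl v -> u = v.
Proof.
move=> uv; apply: omorphism_ext => p; apply: downset_separated => c.
by rewrite -!in_preim_bdl uv.
Qed.

(** The downsets [c] with [p] in [a c] form a prime filter of a finite lattice; its least member is
    the principal downset of the point sought. *)
Lemma bdl_point (a : {bdlmorphism downset L -> downset P}) (p : P) :
  exists l, forall c, (p \in dset (a c)) = (l \in dset c).
Proof.
pose c0 : downset L := \meet_(c : downset L | p \in dset (a c)) c.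
have pc0 : p \in dset (a c0).
  apply: (big_ind (fun c : downset L => p \in dset (a c))) => //.
    by rewrite omorph1 inE.
  by move=> x y px py; rewrite omorphI inE px.
have [l /andP[lc0 pl]|none] :=
    pickP (fun l => (l \in dset c0) && (p \in dset (a (principal l)))).
  exists l => c; apply/idP/idP => [pc|lc].
    have c0c : c0 <= c by exact: meets_inf.
    exact: (subsetP c0c).
  have lec : principal l <= c by rewrite principal_le.
  exact: (subsetP (omorph_le a lec)).
move: pc0.
(* [c0] is the join of the principal downsets of its points; were none of these in the filter,
   primeness would exclude [c0] as well. *)
have -> : c0 = \join_(l in dset c0) principal l.
  apply/le_anti/andP; split; last first.
    by apply/joinsP => l; rewrite principal_le.
  apply/subsetP => l lc0.
  have lec : principal l <= \join_(l in dset c0) principal l by exact: joins_sup.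
  by apply: (subsetP lec); rewrite in_principal.
suff /negbTE -> : p \notin dset (a (\join_(l in dset c0) principal l)) by [].
apply: (big_ind (fun c : downset L => p \notin dset (a c))).
- by rewrite omorph0 inE.
- by move=> x y px py; rewrite omorphU inE negb_or px.
- by move=> l lc0; have := none l; rewrite /= lc0 => /negbT.
Qed.

(** Birkhoff duality on morphisms: choosing the point for every [p] gives the map, and principal
    downsets show that it preserves order. *)
Lemma bdl_preim (a : {bdlmorphism downset L -> downset P}) :
  exists u : {omorphism P -> L}, a =1 preim_bdl u.
Proof.
pose u p := projT1 (cid (bdl_point a p)).
have uP p c : (p \in dset (a c)) = (u p \in dset c).
  exact: projT2 (cid (bdl_point a p)) c.
have u_homo : {homo u : x y / x <= y}.
  move=> x y xy; rewrite -in_principal -uP.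
  by apply: mem_downset xy; rewrite uP in_principal.
pose uM := Order.isOrderMorphism.Build _ _ _ _ u u_homo.
exists (HB.pack_for {omorphism P -> L} u uM) => c.
by apply/val_inj/setP => p; rewrite in_preim_bdl uP.
Qed.

End Preimage.

(** * Finite conjunctions, disjunctions and equations as terms *)

Definition hmeets T (s : seq T) (F : T -> hterm) : hterm :=
  foldr (fun x t => HMeet (F x) t) HTop s.
Definition hjoins T (s : seq T) (F : T -> hterm) : hterm :=
  foldr (fun x t => HJoin (F x) t) HBot s.
Definition hiff (s t : hterm) : hterm := HMeet (HImp s t) (HImp t s).

Section DerivedTerms.
Variables (d : Order.disp_t) (A : heytingType d) (e : nat -> A).

Lemma heval_hmeets T (s : seq T) F :
  heval e (hmeets s F) = \meet_(x <- s) heval e (F x).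
Proof. by elim: s => [|x s IHs] /=; rewrite ?big_nil ?big_cons ?IHs. Qed.

Lemma himp_eq1 (x y : A) : (himp x y == \top) = (x <= y).
Proof. by rewrite -le1x himpP meet1x. Qed.

Lemma heval_hiff s t : heval e (hiff s t) = \top <-> heval e s = heval e t.
Proof.
split=> [/eqP|st]; last by apply/eqP; rewrite /= meet_eq1 !himp_eq1 st lexx.
by rewrite /= meet_eq1 !himp_eq1 => /le_anti.
Qed.

Lemma heval_HMeet_eq1 s t :
  heval e (HMeet s t) = \top <-> heval e s = \top /\ heval e t = \top.
Proof.
split=> [/eqP|[/= -> ->]]; last exact: meetxx.
by rewrite /= meet_eq1 => /andP[/eqP ? /eqP ?].
Qed.

Lemma heval_hmeets_enum (T : finType) F :
  heval e (hmeets (enum T) F) = \top <-> forall x, heval e (F x) = \top.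
Proof.
rewrite heval_hmeets big_enum /=; split=> [h x|h].
  by apply/eqP; rewrite -le1x -h; apply: meets_inf.
by apply/eqP; rewrite -le1x; apply/meetsP => x _; rewrite h.
Qed.

End DerivedTerms.

(** * Algebras freely generated by a finite distributive lattice *)

Section LatticeVariables.
Variables (d : Order.disp_t) (D : finTBDistrLatticeType d).

Definition lvar (c : D) : nat := pickle c.
Definition lvar_val (i : nat) : D := odflt \bot (unpickle i).

Lemma lvarK : cancel lvar lvar_val.
Proof. by move=> c; rewrite /lvar_val pickleK. Qed.

(** Presents the algebra free on the underlying set of [D], with no lattice relations: finite
    approximability speaks of such algebras only. *)
Definition set_presentation : presentation :=
  fun B e => exists a : D -> B, e = a \o lvar_val.

Definition lattice_presentation : presentation :=
  fun B e => exists a : {bdlmorphism D -> B}, e = a \o lvar_val.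

(** Since [D] is finite, all its relations fit in a single term, which can then serve as the left
    side of an inequality. *)
Definition lattice_relations : hterm :=
  HMeet (HMeet (hiff (HVar (lvar \bot)) HBot) (hiff (HVar (lvar \top)) HTop))
    (hmeets (enum {: D * D}) (fun p =>
      HMeet (hiff (HVar (lvar (p.1 `&` p.2))) (HMeet (HVar (lvar p.1)) (HVar (lvar p.2))))
            (hiff (HVar (lvar (p.1 `|` p.2))) (HJoin (HVar (lvar p.1)) (HVar (lvar p.2)))))).

Lemma heval_lattice_relations d' (B : heytingType d') (a : D -> B) :
  heval (a \o lvar_val) lattice_relations = \top <->
  exists a' : {bdlmorphism D -> B}, a = a'.
Proof.
split=> [|[a' ->]].
  move=> /heval_HMeet_eq1[/heval_HMeet_eq1[/heval_hiff a0 /heval_hiff a1]].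
  move=> /heval_hmeets_enum a2.
  rewrite /= lvarK in a0; rewrite /= lvarK in a1.
  have aI : {morph a : x y / x `&` y}.
    by move=> x y; have /heval_HMeet_eq1[/heval_hiff /=] := a2 (x, y); rewrite !lvarK.
  have aU : {morph a : x y / x `|` y}.
    by move=> x y; have /heval_HMeet_eq1[_ /heval_hiff /=] := a2 (x, y); rewrite !lvarK.
  by exists (bdlmorphism_of aI aU a0 a1).
apply/heval_HMeet_eq1; split.
  apply/heval_HMeet_eq1; split; apply/heval_hiff; rewrite /= lvarK.
    exact: omorph0.
  exact: omorph1.
apply/heval_hmeets_enum => -[x y].
apply/heval_HMeet_eq1; split; apply/heval_hiff; rewrite /= !lvarK.
  exact: omorphI.
exact: omorphU.
Qed.

Variable V : variety.

Definition set_free : heytAlg := term_algebra V set_presentation.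

Lemma set_freeP :
  free_on V (fun i : 'I_#|D| => tclass V set_presentation (HVar (lvar (enum_val i))) : set_free).
Proof.
split=> [|B VB a]; first exact: term_algebra_in_variety.
pose a' (c : D) := a (enum_rank c).
have Ka : set_presentation (a' \o lvar_val) by exists a'.
exists (teval VB Ka); split=> [i|f fa].
  by apply: etrans (tevalE VB Ka _) _; rewrite /= lvarK /a' enum_valK.
apply: term_algebra_ext => i; rewrite tevalE /= /a' -fa /= enum_rankK.
congr (f _); apply/tclassP => B' _ e [b ->] /=; by rewrite lvarK.
Qed.

Definition lattice_free : heytAlg := term_algebra V lattice_presentation.

Definition lattice_gen_fun (c : D) : lattice_free :=
  tclass V lattice_presentation (HVar (lvar c)).

Definition lattice_gen : {bdlmorphism D -> lattice_free}.
Proof.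
apply: (@bdlmorphism_of _ _ _ _ lattice_gen_fun) => [x y|x y||];
  apply/tclassP => B VB e [a ->] /=; rewrite ?lvarK.
- rewrite -![heval _ (trepr _)]/(teval_fun _ _).
  have Ka : lattice_presentation (a \o lvar_val) by exists a.
  by rewrite !teval_tclass //= !lvarK omorphI.
- rewrite -![heval _ (trepr _)]/(teval_fun _ _).
  have Ka : lattice_presentation (a \o lvar_val) by exists a.
  by rewrite !teval_tclass //= !lvarK omorphU.
- exact: omorph0.
- exact: omorph1.
Defined.

(* [lvar_val] sends the indices that code no element to [\bot]. *)
Lemma lattice_genE i :
  tclass V lattice_presentation (HVar i) = lattice_gen (lvar_val i).
Proof. by apply/tclassP => B VB e [a ->] /=; rewrite lvarK. Qed.

Section Extension.
Variables (B : heytAlg) (VB : in_variety V B) (a : {bdlmorphism D -> B}).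

Fact lattice_presentation_of : lattice_presentation (a \o lvar_val).
Proof. by exists a. Qed.

Definition lattice_ext : {hmorphism lattice_free -> B} :=
  teval VB lattice_presentation_of.

Lemma lattice_extE t :
  lattice_ext (tclass V lattice_presentation t) = heval (a \o lvar_val) t.
Proof. exact: tevalE. Qed.

Lemma lattice_ext_gen c : lattice_ext (lattice_gen c) = a c.
Proof. by rewrite lattice_extE /= lvarK. Qed.

End Extension.

Lemma lattice_free_eq (B : heytAlg) (f g : {hmorphism lattice_free -> B}) :
  (forall c, f (lattice_gen c) = g (lattice_gen c)) -> f = g.
Proof. by move=> fg; apply: term_algebra_ext => i; rewrite lattice_genE. Qed.

Lemma lattice_freeP : lattice_free_on V lattice_gen.
Proof.
split=> [|B VB a]; first exact: term_algebra_in_variety.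
exists (lattice_ext VB a); split=> [c|f fa]; first exact: lattice_ext_gen.
by apply: lattice_free_eq => c; rewrite lattice_ext_gen -fa.
Qed.

End LatticeVariables.

(** * Uniqueness of free algebras up to isomorphism *)

Section LatticeFreeUniqueness.
Variables (V : variety) (d : Order.disp_t) (D : tbDistrLatticeType d).

Lemma lattice_free_hom_eq (A B : heytAlg) (g : {bdlmorphism D -> A})
  (f1 f2 : {hmorphism A -> B}) :
  lattice_free_on V g -> in_variety V B -> f1 \o g =1 f2 \o g -> f1 = f2.
Proof.
move=> [_ gU] VB f12; have [f [_ fU]] := gU B VB (bdl_comp f2 g).
by rewrite -(fU f1 f12) -(fU f2 (fun=> erefl)).
Qed.

Lemma lattice_free_iso (A B : heytAlg) (g : {bdlmorphism D -> A})
  (h : {bdlmorphism D -> B}) : lattice_free_on V g -> lattice_free_on V h ->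
  exists (i : {hmorphism A -> B}) (j : {hmorphism B -> A}),
    cancel i j /\ cancel j i.
Proof.
move=> gF hF; have [VA gU] := gF; have [VB hU] := hF.
have [i [ig _]] := gU B VB h; have [j [jh _]] := hU A VA g.
exists i, j; split=> x.
  have -> : j (i x) = (j \o i : {hmorphism A -> A}) x by [].
  have -> : (j \o i : {hmorphism A -> A}) = idfun.
    apply: (lattice_free_hom_eq gF VA) => c /=.
    by rewrite -[RHS]jh /= -ig.
  by [].
have -> : i (j x) = (i \o j : {hmorphism B -> B}) x by [].
have -> : (i \o j : {hmorphism B -> B}) = idfun.
  apply: (lattice_free_hom_eq hF VB) => c /=.
  by rewrite -[RHS]ig /= -jh.
by [].
Qed.

(** Serves to replace a finite distributive lattice by the downset lattice of its join primes. *)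
Lemma lattice_free_transport d' (D' : tbDistrLatticeType d') (A : heytAlg)
  (g : {bdlmorphism D -> A}) (i : {bdlmorphism D' -> D}) (j : D -> D') :
  cancel i j -> cancel j i -> lattice_free_on V g -> lattice_free_on V (bdl_comp g i).
Proof.
move=> iK jK [VA gU]; split=> // B VB a.
have [f [fa fU]] := gU B VB (bdl_comp a (bdlmorphism_inv iK jK)).
exists f; split=> [c|f' f'a]; first by rewrite /= -[f _]/((f \o g) _) fa /= iK.
by apply: fU => c; rewrite -[c in LHS]jK -[LHS]/((f' \o (g \o i)) _) f'a.
Qed.

End LatticeFreeUniqueness.

(** * Finite rooted posets detect equality in the free algebras *)

(** Every valuation factors through the algebra free on the set [D], which embeds into a product of
    finite algebras; there the inequality is checked componentwise. *)
Lemma finitely_approximable_le V d (D : finTBDistrLatticeType d) s t :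
  finitely_approximable V ->
  (forall A : finHeytAlg, in_variety V A -> forall a : D -> A,
     heval (a \o lvar_val D) s <= heval (a \o lvar_val D) t) ->
  forall B : heytAlg, in_variety V B -> forall a : D -> B,
     heval (a \o lvar_val D) s <= heval (a \o lvar_val D) t.
Proof.
move=> hV finle B VB a.
pose E i : set_free D V := tclass V (set_presentation D) (HVar i).
(* Each index is identified with the code of the element it decodes to, which is [\bot] for an index
   that codes nothing. *)
have EE : E =1 (E \o @lvar _ D) \o lvar_val D.
  by move=> i; apply/tclassP => B' _ e [b ->] /=; rewrite lvarK.
have Ka : set_presentation D (a \o lvar_val D) by exists a.
have -> : a \o lvar_val D = teval VB Ka \o E.
  by apply/funext => i; apply/esym/tevalE.
rewrite -!heval_hmorphism; apply: omorph_le.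
have [I [A [VA [f f_inj]]]] := hV _ _ _ (set_freeP D V).
rewrite -(injective_hmorphism_le f_inj) !heval_hmorphism.
apply/asboolP => i; rewrite !heval_prod.
have fE : (fun k => (f \o E) k i) =1 (fun c => f (E (lvar c)) i) \o lvar_val D.
  by move=> k /=; rewrite EE.
by rewrite !(heval_ext _ fE); apply: (finle (A i)).
Qed.

Section Trace.
Variables (d : Order.disp_t) (P : finPOrderType d) (p : P).

Lemma down_trace_eq1 (A : downset P) :
  (down_trace p A == \top) = (p \in dset A).
Proof.
apply/eqP/idP => [|pA].
  move=> /(congr1 (fun B => (\top : down p) \in dset B)).
  by rewrite !inE.
apply/val_inj/setP => q; rewrite !inE.
exact: mem_downset pA (valP q).
Qed.

End Trace.

(** Birkhoff's theorem turns [A] into an algebra of downsets; restriction to the points below a join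
    prime separating [x] from [y] sends [x], but not [y], to [\top]. *)
Lemma finite_heyting_counterexample V (A : finHeytAlg) (x y : A) :
  in_variety V A -> ~~ (x <= y) ->
  exists (P : P0 V) (h : A -> downset (sval P)),
    (forall e t, h (heval e t) = heval (h \o e) t) /\ h x = \top /\ h y <> \top.
Proof.
move=> VA /join_primes_separate[j jx jy].
pose theta : {hmorphism A -> downset (join_primes A)} :=
  hmorphism_of (bijective_bdlmorphism_himp (@birkhoffK _ A) (@birkhoff_invK _ A)).
have VJ : in_variety V (downset (join_primes A)).
  exact: (in_variety_surjection (f := theta) (@birkhoff_invK _ A) VA).
pose P : P0 V := exist _ (RootedPoset (down j)) (@down_in_variety _ _ j V VJ).
exists P, (down_trace j \o theta); split=> [e t|].
  rewrite -[LHS]/(down_trace j (theta (heval e t))).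
  by rewrite heval_hmorphism heval_down_trace.
by split; apply/eqP; rewrite /= down_trace_eq1 in_birkhoff.
Qed.

Theorem rooted_completeness V d (D : finTBDistrLatticeType d) s t :
  finitely_approximable V ->
  (forall (P : P0 V) (a : {bdlmorphism D -> downset (sval P)}),
     heval (a \o lvar_val D) s = heval (a \o lvar_val D) t) ->
  teq V (lattice_presentation D) s t.
Proof.
move=> hV st B VB _ [a ->].
pose r := lattice_relations D.
(* With the relations moved into the premise [r], the inequality must hold for arbitrary maps from
   [D], the form in which finite approximability applies. *)
suff le_r : heval (a \o lvar_val D) r <= heval (a \o lvar_val D) (hiff s t).
  apply/heval_hiff/eqP; rewrite -le1x -{1}(_ : heval (a \o lvar_val D) r = \top) //.
  by apply/heval_lattice_relations; exists a.
apply: (finitely_approximable_le hV) VB a => A VA b.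
apply/negPn/negP.
move=> /(finite_heyting_counterexample VA)[P [h [hE [hr hst]]]].
rewrite hE in hr; rewrite hE in hst.
(* As [r] takes the value [\top], the refuting valuation is a lattice morphism, so it falls under
   the hypothesis. *)
have [a' ha'] := proj1 (heval_lattice_relations (h \o b)) hr.
have E : h \o (b \o lvar_val D) =1 a' \o lvar_val D by move=> i /=; rewrite -ha'.
by apply: hst; apply/heval_hiff; rewrite !(heval_ext _ E).
Qed.

(** * Bisimulation types *)

Section BisimulationTypes.
Variable L : finPoset.

(** Codes for the classes of ~_n: hereditarily finite sets over [L]. The same finite type serves all
    posets, so classes of evaluations on different posets are compared by equality. *)
Fixpoint types (n : nat) : finType :=
  if n is n'.+1 then {set types n'} else L.

(** Types decrease along [q <= p], so a downset can cut out the points whose type is below a given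
    one, but in general not those of exactly one type. *)
Definition type_le (n : nat) : rel (types n) :=
  match n return rel (types n) with
  | 0 => fun s t => (s : L) <= t
  | n'.+1 => fun s t => (s : {set types n'}) \subset t
  end.

Lemma type_le_refl n (t : types n) : type_le t t.
Proof. by case: n t => [|n] t /=. Qed.

Lemma type_le_anti n (s t : types n) : type_le s t -> type_le t s -> s = t.
Proof.
case: n s t => [|n] s t /= st ts; first by apply/le_anti; rewrite st.
by apply/eqP; rewrite eqEsubset st.
Qed.

Section Type_of.
Variables (d : Order.disp_t) (P : finPOrderType d) (u : {omorphism P -> L}).

Fixpoint bisim_type (n : nat) (p : P) : types n :=
  match n return types n with
  | 0 => u p
  | n'.+1 => [set bisim_type n' q | q in [set q | q <= p]]
  end.

Lemma bisim_typeSP n p t :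
  reflect (exists2 q, q <= p & bisim_type n q = t) (t \in (bisim_type n.+1 p : {set _})).
Proof.
apply: (iffP imsetP) => [[q]|[q qp <-]]; first by rewrite inE => qp ->; exists q.
by exists q; rewrite ?inE.
Qed.

End Type_of.

Lemma bisim_typeS_eq n d (P : finPOrderType d) (u : {omorphism P -> L})
  d' (Q : finPOrderType d') (v : {omorphism Q -> L}) (p : P) (q : Q) :
  bisim_type u n.+1 p = bisim_type v n.+1 q <->
  (forall p', p' <= p -> exists2 q', q' <= q & bisim_type u n p' = bisim_type v n q') /\
  (forall q', q' <= q -> exists2 p', p' <= p & bisim_type u n p' = bisim_type v n q').
Proof.
split=> [uv|[uv vu]].
  split=> [p' p'p|q' q'q].
    have /bisim_typeSP[q' q'q q'p'] : bisim_type u n p' \in (bisim_type v n.+1 q : {set _}).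
      by rewrite -uv; apply/bisim_typeSP; exists p'.
    by exists q'.
  have /bisim_typeSP[p' p'p q'p'] : bisim_type v n q' \in (bisim_type u n.+1 p : {set _}).
    by rewrite uv; apply/bisim_typeSP; exists q'.
  by exists p'.
apply/setP => t; apply/bisim_typeSP/bisim_typeSP => [[p' /uv[q' q'q ->] <-]|[q' /vu[p' p'p <-] <-]].
  by exists q'.
by exists p'.
Qed.

(** Openness lifts every point below [h q] to a point below [q], so the same types occur below
    both. *)
Lemma bisim_type_open n d (P : finPOrderType d) (u : {omorphism P -> L})
  d' (Q : finPOrderType d') (h : openMap Q P) (q : Q) :
  bisim_type (u \o h) n q = bisim_type u n (h q).
Proof.
elim: n q => // n IHn q; apply/bisim_typeS_eq; split=> [q' q'q|p' /open_mapP[q' q'q <-]].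
  by exists (h q'); rewrite ?IHn //; apply: omorph_le.
by exists q'.
Qed.

Lemma bisim_type_eval_at n d (P : finPOrderType d) (u : {omorphism P -> L})
  (p : P) (q : down p) : bisim_type (eval_at u p) n q = bisim_type u n (val q).
Proof. exact: (bisim_type_open n u (down_open p)). Qed.

(** Every point is below the root, and restricting an evaluation to a principal downset leaves the
    types of its points unchanged. *)
Lemma bisimP n d (P : finTPOrderType d) (u : {omorphism P -> L})
  d' (Q : finTPOrderType d') (v : {omorphism Q -> L}) :
  bisim n u v <-> bisim_type u n \top = bisim_type v n \top.
Proof.
elim: n d P u d' Q v => [|n IHn] d P u d' Q v //.
rewrite bisim_typeS_eq; split=> -[uv vu]; split.
- by move=> p _; have [q /IHn] := uv p; rewrite !bisim_type_eval_at; exists q; rewrite ?lex1.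
- by move=> q _; have [p /IHn] := vu q; rewrite !bisim_type_eval_at; exists p; rewrite ?lex1.
- move=> p; have [|q _ pq] := uv p; first exact: lex1.
  by exists q; apply/IHn; rewrite !bisim_type_eval_at.
- move=> q; have [|p _ pq] := vu q; first exact: lex1.
  by exists p; apply/IHn; rewrite !bisim_type_eval_at.
Qed.

Lemma bisim_type_pred n d (P : finPOrderType d) (u : {omorphism P -> L})
  d' (Q : finPOrderType d') (v : {omorphism Q -> L}) (p : P) (q : Q) :
  bisim_type u n.+1 p = bisim_type v n.+1 q -> bisim_type u n p = bisim_type v n q.
Proof.
elim: n p q => [|n IHn] p q /bisim_typeS_eq[uv vu].
  have [q' q'q pq'] := uv p (lexx p); have [p' p'p p'q] := vu q (lexx q).
  (* Level 0 needs antisymmetry: [u p = v q'] is below [v q], and [v q = u p'] is below [u p]. *)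
  apply/le_anti/andP; split.
    by rewrite pq'; apply: omorph_le.
  by rewrite -p'q; apply: omorph_le.
apply/bisim_typeS_eq; split=> [p' /uv[q' q'q]|q' /vu[p' p'p]] /IHn p'q'.
  by exists q'.
by exists p'.
Qed.

Lemma bisim_type_le m n d (P : finPOrderType d) (u : {omorphism P -> L})
  d' (Q : finPOrderType d') (v : {omorphism Q -> L}) (p : P) (q : Q) :
  (m <= n)%N -> bisim_type u n p = bisim_type v n q ->
  bisim_type u m p = bisim_type v m q.
Proof.
move=> /subnK <-; elim: (n - m)%N => // k IHk.
by rewrite addSn => /bisim_type_pred.
Qed.

End BisimulationTypes.

(** * Terms in downset algebras and definability of types *)

Section HevalDownset.
Variables (d : Order.disp_t) (P : finPOrderType d) (e : nat -> downset P).

Lemma in_heval_hmeets T (s : seq T) F p :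
  (p \in dset (heval e (hmeets s F))) = all (fun x => p \in dset (heval e (F x))) s.
Proof. by elim: s => [|x s IHs] /=; rewrite !inE // IHs. Qed.

Lemma in_heval_hjoins T (s : seq T) F p :
  (p \in dset (heval e (hjoins s F))) = has (fun x => p \in dset (heval e (F x))) s.
Proof. by elim: s => [|x s IHs] /=; rewrite !inE // IHs. Qed.

Lemma in_heval_himp s t p :
  reflect (forall q, q <= p -> q \in dset (heval e s) -> q \in dset (heval e t))
    (p \in dset (heval e (HImp s t))).
Proof.
rewrite inE; apply: (iffP forall_inP) => h q.
  by move=> qp /h /implyP; apply.
by move=> qs; apply/implyP => qp; apply: h.
Qed.

End HevalDownset.

Section CharacteristicTerms.
Variables (L : finPoset) (var : L -> hterm).

(* A point whose type at level [n.+1] is not contained in [S] has below it a point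
   of some type [t \notin S]; that point satisfies the characteristic term of [t]
   but none of those of the types strictly below [t]. *)
Fixpoint char_term (n : nat) : types L n -> hterm :=
  match n return types L n -> hterm with
  | 0 => var
  | n'.+1 => fun S =>
      hmeets (enum [pred t | t \notin (S : {set _})])
        (fun t => HImp (char_term t) (hjoins (enum [pred t' | type_le t' t && (t' != t)]) (@char_term n')))
  end.

Lemma in_char_term d (P : finPOrderType d) (u : {omorphism P -> L})
    (e : nat -> downset P) :
  (forall l p, (p \in dset (heval e (var l))) = (u p <= l)) ->
  forall n (t : types L n) p,
    (p \in dset (heval e (char_term t))) = type_le (bisim_type u n p) t.
Proof.
move=> eu; elim=> [|n IHn] S p; first exact: eu.
rewrite in_heval_hmeets.
apply/allP/subsetP => [h t /bisim_typeSP[q qp <-{t}]|h t].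
  (* If the type of [q] were outside [S], its implication would place it below a type strictly
     smaller than itself. *)
  apply/negPn/negP => qS; have := h (bisim_type u n q).
  rewrite mem_enum => /(_ qS)/in_heval_himp/(_ q qp).
  rewrite IHn type_le_refl in_heval_hjoins => /(_ isT)/hasP[t].
  rewrite mem_enum IHn => /andP[tq /negP qt] /type_le_anti qtE.
  by apply: qt; rewrite qtE.
rewrite mem_enum => tS; apply/in_heval_himp => q qp.
rewrite IHn => qt; rewrite in_heval_hjoins; apply/hasP.
(* The type of [q] is in [S] and [t] is not, so it is strictly below [t] and its own disjunct holds
   at [q]. *)
have qS : bisim_type u n q \in (S : {set _}) by apply: h; apply/bisim_typeSP; exists q.
exists (bisim_type u n q); last by rewrite IHn type_le_refl.
by rewrite mem_enum inE qt; apply: contraNneq tS => <-.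
Qed.

End CharacteristicTerms.

(** Only implication looks at lower points and costs a level; the other connectives take the
    maximum. The level is uniform in the posets, as a b-index must be. *)
Lemma heval_bisim_invariant (L : finPoset) (var : nat -> downset L) t :
  exists n, forall d (P : finPOrderType d) (u : {omorphism P -> L})
    d' (Q : finPOrderType d') (v : {omorphism Q -> L}) (p : P) (q : Q),
    bisim_type u n p = bisim_type v n q ->
    (p \in dset (heval (preim_bdl u \o var) t)) =
    (q \in dset (heval (preim_bdl v \o var) t)).
Proof.
elim: t => [i|||s [m sm] t [n tn]|s [m sm] t [n tn]|s [m sm] t [n tn]].
- by exists 0 => d P u d' Q v p q /= pq; rewrite !in_preim_bdl pq.
- by exists 0 => *; rewrite !inE.
- by exists 0 => *; rewrite !inE.
- exists (maxn m n) => d P u d' Q v p q pq; rewrite !inE.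
  rewrite (sm _ _ _ _ _ _ p q (bisim_type_le (leq_maxl m n) pq)).
  by rewrite (tn _ _ _ _ _ _ p q (bisim_type_le (leq_maxr m n) pq)).
- exists (maxn m n) => d P u d' Q v p q pq; rewrite !inE.
  rewrite (sm _ _ _ _ _ _ p q (bisim_type_le (leq_maxl m n) pq)).
  by rewrite (tn _ _ _ _ _ _ p q (bisim_type_le (leq_maxr m n) pq)).
exists (maxn m n).+1 => d P u d' Q v p q /bisim_typeS_eq[uv vu].
apply/in_heval_himp/in_heval_himp => h.
  move=> q' /vu[p' p'p pq']; have := h p' p'p.
  rewrite (sm _ _ _ _ _ _ p' q' (bisim_type_le (leq_maxl m n) pq')).
  by rewrite (tn _ _ _ _ _ _ p' q' (bisim_type_le (leq_maxr m n) pq')).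
move=> p' /uv[q' q'q pq']; have := h q' q'q.
rewrite (sm _ _ _ _ _ _ p' q' (bisim_type_le (leq_maxl m n) pq')).
by rewrite (tn _ _ _ _ _ _ p' q' (bisim_type_le (leq_maxr m n) pq')).
Qed.

(* Level [n.+1] is needed: inclusion of types at that level gives every point a
   partner with the same type at level [n], so the set of types sent into [c] is
   closed downwards, which need not hold at level [n]. *)
Lemma natural_bisim_definable V (L M : finPoset) (var : L -> hterm)
    (f : MH_hom V L M) (c : downset M) :
  exists t, forall (P : P0 V) (u : {omorphism sval P -> L}) (e : nat -> downset (sval P)),
    (forall l p, (p \in dset (heval e (var l))) = (u p <= l)) ->
    forall p, (p \in dset (heval e t)) = (sval f P u p \in dset c).
Proof.
case: f => f [n fn] /=.
pose W := [pred t : types L n.+1 | `[< exists (Q : P0 V) (v : {omorphism sval Q -> L}),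
  bisim_type v n.+1 \top = t /\ f Q v \top \in dset c >]].
exists (hjoins (enum W) (@char_term L var n.+1)) => P u e eu p.
have f_at (Q : P0 V) (v : {omorphism sval Q -> L}) q :
    f Q v q = f (down_P0 q) (eval_at v q) \top by rewrite -natural_eval_at.
rewrite in_heval_hjoins; apply/hasP/idP => [[t]|pc].
  rewrite mem_enum => /asboolP[Q [v [<- vc]]].
  rewrite (in_char_term eu) => /subsetP/(_ (bisim_type u n p)).
  case/(_ _)/bisim_typeSP; first by apply/bisim_typeSP; exists p.
  move=> q _ qp; have -> : f P u p = f Q v q.
    (* Values at [p] and [q] are root values of the restricted evaluations, to which the b-index
       applies. *)
    rewrite (f_at P u p) (f_at Q v q); apply/fn/bisimP.
    by rewrite !bisim_type_eval_at.
  apply: mem_downset vc _; apply: omorph_le; exact: lex1.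
exists (bisim_type u n.+1 p); last by rewrite (in_char_term eu) type_le_refl.
rewrite mem_enum; apply/asboolP; exists (down_P0 p), (eval_at u p).
by split; [rewrite bisim_type_eval_at|rewrite -f_at].
Qed.

(** * The duality *)

Section Duality.
Variable V : variety.

Definition downset_algebra (P : P0 V) : heytAlg := HeytAlg (downset (sval P)).

Definition free_downset (L : finPoset) : heytAlg := lattice_free (downset L) V.
Definition free_gen (L : finPoset) : {bdlmorphism downset L -> free_downset L} :=
  lattice_gen (downset L) V.

(** Kripke semantics: [p] lies in [evaluate u x] when [x] is forced at [p] under [u]. *)
Definition evaluate (L : finPoset) (P : P0 V) (u : {omorphism sval P -> L}) :
    {hmorphism free_downset L -> downset_algebra P} :=
  @lattice_ext _ (downset L) V (downset_algebra P) (svalP P) (preim_bdl u).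

Lemma evaluate_gen (L : finPoset) (P : P0 V) (u : {omorphism sval P -> L}) c :
  evaluate u (free_gen L c) = preim_bdl u c.
Proof. exact: lattice_ext_gen. Qed.

Lemma evaluate_tclass (L : finPoset) (P : P0 V) (u : {omorphism sval P -> L}) t :
  evaluate u (tclass V (lattice_presentation (downset L)) t) =
  heval (preim_bdl u \o lvar_val (downset L)) t.
Proof. exact: lattice_extE. Qed.

Lemma evaluate_inj (L : finPoset) (P : P0 V) (u v : {omorphism sval P -> L}) :
  (forall x, evaluate u x = evaluate v x) -> u = v.
Proof.
by move=> uv; apply: preim_bdl_inj => c; rewrite -!evaluate_gen.
Qed.

(** Freeness reduces a homomorphism to its restriction to the generators, a lattice morphism and
    hence a preimage map. *)
Lemma evaluate_hmorphism (L : finPoset) (P : P0 V)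
  (h : {hmorphism free_downset L -> downset_algebra P}) :
  exists u : {omorphism sval P -> L}, forall x, h x = evaluate u x.
Proof.
have [u hu] := bdl_preim (bdl_comp h (free_gen L)).
exists u => x; suff -> : h = evaluate u by [].
by apply: lattice_free_eq => c; rewrite evaluate_gen -hu.
Qed.

Lemma evaluate_invariant (L : finPoset) (x : free_downset L) :
  exists n, forall (P Q : P0 V) (u : {omorphism sval P -> L}) (v : {omorphism sval Q -> L})
    (p : sval P) (q : sval Q), bisim_type u n p = bisim_type v n q ->
    (p \in dset (evaluate u x)) = (q \in dset (evaluate v x)).
Proof.
have [n nP] := heval_bisim_invariant (lvar_val (downset L)) (trepr x).
by exists n => P Q u v p q pq; rewrite -(treprK x) !evaluate_tclass (nP _ _ _ _ _ _ _ _ pq).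
Qed.

(** Forcing depends only on the type at some level, and open maps preserve all types. *)
Lemma evaluate_open (L : finPoset) (P Q : P0 V) (u : {omorphism sval P -> L})
  (k : openMap (sval Q) (sval P)) x q :
  (q \in dset (evaluate (u \o k : {omorphism sval Q -> L}) x)) =
  (k q \in dset (evaluate u x)).
Proof.
by have [n] := evaluate_invariant x; apply; apply: bisim_type_open.
Qed.

(** The correspondence of morphisms is kept as a relation: it is total and injective in both
    directions, so functoriality reduces to uniqueness. *)
Definition represents (L M : finPoset) (f : MH_hom V L M)
    (h : {hmorphism free_downset M -> free_downset L}) : Prop :=
  forall (P : P0 V) (u : {omorphism sval P -> L}) x,
    evaluate u (h x) = evaluate (sval f P u) x.

Lemma represents_id L : represents (MH_id V L) idfun.
Proof. by []. Qed.

Lemma represents_comp L M N (g : MH_hom V M N) (f : MH_hom V L M) h k :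
  represents g k -> represents f h -> represents (MH_comp g f) (h \o k).
Proof. by move=> gk fh P u x; apply: etrans (fh P u (k x)) (gk _ _ x). Qed.

Lemma represents_MH_inj L M (f f' : MH_hom V L M) h :
  represents f h -> represents f' h -> f = f'.
Proof.
move=> fh f'h; apply: MH_hom_ext => P u; apply: evaluate_inj => x.
by rewrite -fh f'h.
Qed.

(** [f P u] is the evaluation that induces the composite of [evaluate u] with [h]; naturality comes
    from the invariance of forcing under open maps. *)
Lemma hmorphism_representable L M (h : {hmorphism free_downset M -> free_downset L}) :
  exists f : MH_hom V L M, represents f h.
Proof.
pose f (P : P0 V) (u : {omorphism sval P -> L}) : {omorphism sval P -> M} :=
  projT1 (cid (evaluate_hmorphism (evaluate u \o h : {hmorphism _ -> _}))).
have fP P u x : evaluate u (h x) = evaluate (f P u) x.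
  exact: projT2 (cid (evaluate_hmorphism (evaluate u \o h : {hmorphism _ -> _}))) x.
have fin P u c p : (p \in dset (evaluate u (h (free_gen M c)))) = (f P u p \in dset c).
  by rewrite fP evaluate_gen in_preim_bdl.
have nat (P Q : P0 V) (k : openMap (sval Q) (sval P)) (u : {omorphism sval P -> L}) :
    f Q (u \o k : {omorphism sval Q -> L}) = f P u \o k.
  apply: omorphism_ext => q; apply: downset_separated => c.
  by rewrite -fin evaluate_open fin.
have natf a b (k : @hom (opposite (P0 V)) a b) :
    @comp typeCat _ _ _ (f b) (fmap (evaluations V L) k) =
    @comp typeCat _ _ _ (fmap (evaluations V M) k) (f a).
  by apply/funext => u; exact: nat.
pose n c := projT1 (cid (evaluate_invariant (h (free_gen M c)))).
have nP c := projT2 (cid (evaluate_invariant (h (free_gen M c)))).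
(* There are finitely many downsets [c], so the largest of their levels decides the images of all
   generators, and these determine the value at the root. *)
have fn : has_b_index (@Natural _ _ (evaluations V L) (evaluations V M) f natf)
    (\max_(c : downset M) n c)%N.
  move=> P Q u v /bisimP uv; apply: downset_separated => c.
  rewrite /= -!fin; apply: nP; apply: bisim_type_le uv.
  exact: (leq_bigmax c).
pose fM : MH_hom V L M := exist _ _ (ex_intro (has_b_index _) _ fn).
by exists fM => P u x; apply: fP.
Qed.

Hypothesis hV : finitely_approximable V.

(** Lattice morphisms into downset algebras are preimage maps, so completeness over [P0 V] becomes
    separation by evaluations. *)
Lemma evaluate_separates (L : finPoset) (x y : free_downset L) :
  (forall (P : P0 V) (u : {omorphism sval P -> L}), evaluate u x = evaluate u y) ->
  x = y.
Proof.
move=> xy; rewrite -(treprK x) -(treprK y); apply/tclassP.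
apply: rooted_completeness => // P a; have [u au] := bdl_preim a.
have E : a \o lvar_val (downset L) =1 preim_bdl u \o lvar_val (downset L).
  by move=> i /=; rewrite au.
rewrite !(heval_ext _ E) -!evaluate_tclass !treprK; exact: xy.
Qed.

Lemma represents_hmorphism_inj L M (f : MH_hom V L M) h h' :
  represents f h -> represents f h' -> h = h'.
Proof.
move=> fh fh'; apply: hmorphism_ext => x; apply: evaluate_separates => P u.
by rewrite fh fh'.
Qed.

(** One term defines the preimage of [c] under the image of every evaluation. The classes of these
    terms satisfy the lattice laws because all their evaluations do, so freeness extends them to a
    homomorphism. *)
Lemma MH_hom_representable L M (f : MH_hom V L M) : exists h, represents f h.
Proof.
(* The generator for the principal downset of [l] is forced at [p] exactly when [u p <= l], as
   characteristic terms require at level 0. *)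
pose var (l : L) := HVar (lvar (principal l)).
pose t c := projT1 (cid (natural_bisim_definable var f c)).
pose a c : free_downset L := tclass V (lattice_presentation (downset L)) (t c).
have aP P u c : evaluate u (a c) = preim_bdl (sval f P u) c.
  rewrite /a evaluate_tclass; apply/val_inj/setP => p; rewrite in_preim_bdl.
  apply: (projT2 (cid (natural_bisim_definable var f c))) => l q.
  by rewrite /= lvarK in_preim_bdl in_principal.
have aI : {morph a : x y / x `&` y}.
  move=> x y; apply: evaluate_separates => P u.
  have -> : evaluate u (a x `&` a y) = evaluate u (a x) `&` evaluate u (a y).
    exact: omorphI.
  by rewrite !aP; apply: omorphI.
have aU : {morph a : x y / x `|` y}.
  move=> x y; apply: evaluate_separates => P u.
  have -> : evaluate u (a x `|` a y) = evaluate u (a x) `|` evaluate u (a y).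
    exact: omorphU.
  by rewrite !aP; apply: omorphU.
have a0 : a \bot = \bot.
  apply: evaluate_separates => P u; rewrite aP.
  by apply: etrans (omorph0 _) (esym (omorph0 (evaluate u))).
have a1 : a \top = \top.
  apply: evaluate_separates => P u; rewrite aP.
  by apply: etrans (omorph1 _) (esym (omorph1 (evaluate u))).
pose h : {hmorphism free_downset M -> free_downset L} :=
  lattice_ext (proj1 (lattice_freeP (downset L) V)) (bdlmorphism_of aI aU a0 a1).
exists h => P u x.
suff -> : evaluate (sval f P u) = evaluate u \o h :> {hmorphism _ -> _} by [].
apply: lattice_free_eq => c.
rewrite -[RHS]/(evaluate u (h (free_gen M c))) evaluate_gen -aP.
by congr (evaluate u _); apply/esym/lattice_ext_gen.
Qed.

Definition MH_to_HD_map L M (f : MH_hom V L M) :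
    {hmorphism free_downset M -> free_downset L} :=
  projT1 (cid (MH_hom_representable f)).

Lemma MH_to_HD_mapP L M (f : MH_hom V L M) : represents f (MH_to_HD_map f).
Proof. exact: projT2 (cid (MH_hom_representable f)). Qed.

Definition MH_to_HD_obj (L : finPoset) : HD V :=
  exist _ (free_downset L) (ex_intro _ _ (ex_intro _ (downset L : finTBDistrLatticeType _)
    (ex_intro _ (free_gen L) (lattice_freeP (downset L) V)))).

Definition MH_to_HD : functor (opposite (MH V)) (HD V).
Proof.
apply: (@Functor (opposite (MH V)) (HD V) MH_to_HD_obj
  (fun M L f => MH_to_HD_map f)) => [L|N M L g f].
  exact: represents_hmorphism_inj (MH_to_HD_mapP _) (@represents_id L).
apply: represents_hmorphism_inj (MH_to_HD_mapP _) _.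
exact: represents_comp (MH_to_HD_mapP _) (MH_to_HD_mapP _).
Defined.

End Duality.

Theorem mainTheorem2 (V : variety) (hV : finitely_approximable V) :
  dual (HD V) (MH V).
Proof.
apply: (ff_essentially_surjective_equivalent (G := MH_to_HD hV)) => [M L h|[A AH]].
  have [f fh] := hmorphism_representable h; exists f; split=> [|f' f'h].
    exact: represents_hmorphism_inj hV _ _ _ _ _ (MH_to_HD_mapP hV f) fh.
  apply: represents_MH_inj fh _; rewrite -f'h; exact: MH_to_HD_mapP.
have [d [D [g gF]]] := AH.
(* Essential surjectivity: [D] is the downset lattice of [J], so [A] is free on that lattice too,
   and free algebras on it are isomorphic. *)
pose J := FinPoset (join_primes D).
have giF := lattice_free_transport (@birkhoff_invK _ D) (@birkhoffK _ D)
  (i := bdlmorphism_inv (@birkhoffK _ D) (@birkhoff_invK _ D)) gF.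
have [i [j [ij ji]]] := lattice_free_iso giF (lattice_freeP (downset J) V).
exists J, i, j; split; exact: hmorphism_ext.
Qed.
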